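(* Suppose $S$ is a depiction of $R$. Then the sheafification $\tilde S$ of the $R$-module $S$ on $\operatorname{Spec}R$ is a sheaf of depictions on $\operatorname{Spec}R$.
   Context: $k$ is an algebraically closed field. $S$ is an integral domain and a finitely generated $k$-algebra, and $R\subseteq S$ is a subalgebra. $S$ is a depiction of $R$ if the map $\operatorname{Spec}S\to\operatorname{Spec}R$, $\mathfrak q\mapsto\mathfrak q\cap R$, is surjective, and $$U_{S/R}:=\{\mathfrak n\in\operatorname{Max}S : R_{\mathfrak n\cap R}=S_{\mathfrak n}\}=\{\mathfrak n\in\operatorname{Max}S : R_{\mathfrak n\cap R}\text{ is noetherian}\}\neq\emptyset.$$ A sheaf of depictions on an affine scheme $(X,\mathcal O)$ is a sheaf of algebras $\mathcal S$ on $X$ such that on each (nonempty) principal open set $D(a)\subset X$, $a\in\mathcal O(X)$, the algebra $\mathcal S(D(a))$ is a depiction of $\mathcal O(D(a))$. The sheafification $\tilde M$ of an $R$-module $M$ on $X=\operatorname{Spec}R$ is the sheaf of modules with $\tilde M(D(a))=M\otimes_RR[a^{-1}]$ on principal open sets and $\tilde M(U)=\varprojlim_{D(a)\subset U}\tilde M(D(a))$ on general open sets $U$. *)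

(* Defs.v *)
(* Algebras are given by their structure morphisms: a k-algebra is a commutative
   ring A with a ring morphism k -> A, and an R-algebra is a ring morphism R -> S.
   Rings are [comPzRingType]s, so that the zero ring (for instance the sections
   over the empty set) is allowed. *)
From HB Require Import structures.
From mathcomp Require Import all_boot all_order all_algebra.
From mathcomp Require Import generic_quotient ring.
From mathcomp Require Import boolp classical_sets topology.

Set Implicit Arguments.
Unset Strict Implicit.
Unset Printing Implicit Defensive.

Import GRing.Theory.
Local Open Scope classical_set_scope.
Local Open Scope ring_scope.
Local Open Scope quotient_scope.

Section Rings.
Variable A : comPzRingType.
Implicit Types I p m : set A.

Definition ideal I : Prop :=
  [/\ I 0, forall x y, I x -> I y -> I (x + y) & forall a x, I x -> I (a * x)].

Definition prime_ideal p : Prop :=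
  [/\ ideal p, ~ p 1 & forall x y, p (x * y) -> p x \/ p y].

Definition maximal_ideal m : Prop :=
  [/\ ideal m, ~ m 1 & forall I, ideal I -> m `<=` I -> I 1 \/ I = m].

Definition noetherian : Prop :=
  forall I, ideal I ->
    exists s : seq A, (forall x, x \in s -> I x) /\
      forall J, ideal J -> (forall x, x \in s -> J x) -> I `<=` J.

Definition integral_domain : Prop :=
  (1 : A) <> 0 /\ forall x y : A, x * y = 0 -> x = 0 \/ y = 0.

Definition finitely_generated (k : pzRingType) (eta : {rmorphism k -> A}) : Prop :=
  exists s : seq A, forall B : set A,
    (forall c, B (eta c)) ->
    (forall x y, B x -> B y -> B (x + y)) ->
    (forall x y, B x -> B y -> B (x * y)) ->
    (forall x, x \in s -> B x) -> B = setT.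

End Rings.

Arguments noetherian : clear implicits.
Arguments integral_domain : clear implicits.

Record spec (A : comPzRingType) := Spec {
  spec_set :> A -> Prop;
  specP : prime_ideal spec_set }.

HB.instance Definition _ A := gen_eqMixin (spec A).
HB.instance Definition _ A := gen_choiceMixin (spec A).

Definition Max (A : comPzRingType) : set (spec A) := [set q | maximal_ideal q].

Definition principal_open (A : comPzRingType) (a : A) : set (spec A) :=
  [set p : spec A | ~ p a].
Local Notation D := principal_open.

Section Zariski.
Variable A : comPzRingType.

Definition zariski_open (U : set (spec A)) : Prop :=
  forall p, U p -> exists a, D a p /\ D a `<=` U.

Lemma principal_openM (a b : A) : D (a * b) = D a `&` D b.
Proof.
apply/seteqP; split=> [p /= nab|p [na nb] /= ab].
  have [[_ _ pM] _ _] := specP p.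
  by split=> h; apply: nab; [rewrite mulrC|]; exact: pM.
by have [_ _ /(_ _ _ ab)[]] := specP p.
Qed.

Lemma zariski_openT : zariski_open setT.
Proof. by move=> p _; exists 1; split=> //; have [] := specP p. Qed.

Lemma zariski_openI : setI_closed zariski_open.
Proof.
move=> U V oU oV p [/oU[a [pa aU]] /oV[b [pb bV]]].
by exists (a * b); rewrite principal_openM; split=> // q [/aU ? /bV].
Qed.

Lemma zariski_open_bigU (I : Type) (f : I -> set (spec A)) :
  (forall i, zariski_open (f i)) -> zariski_open (\bigcup_i f i).
Proof.
move=> of_ p [i _ /of_[a [pa af]]].
by exists a; split=> // q /af fq; exists i.
Qed.

HB.instance Definition _ := isOpenTopological.Build (spec A)
  zariski_openT zariski_openI zariski_open_bigU.

Lemma zariski_openE (U : set (spec A)) : open U = zariski_open U.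
Proof. by []. Qed.

End Zariski.

Section SpecMap.
Variables (R S : comPzRingType) (phi : {rmorphism R -> S}).

Lemma preimage_prime (q : spec S) : prime_ideal (phi @^-1` spec_set q).
Proof.
have [[q0 qD qM] q1 qP] := specP q; split=> [||x y] /=.
- split=> [|x y|a x] /=; first by rewrite rmorph0.
    by rewrite rmorphD; exact: qD.
  by rewrite rmorphM; exact: qM.
- by rewrite rmorph1.
- by rewrite rmorphM; exact: qP.
Qed.

Definition spec_map (q : spec S) : spec R := Spec (preimage_prime q).

End SpecMap.

Record mulset (A : comPzRingType) := MulSet {
  mset :> A -> Prop;
  mset1 : mset 1;
  msetM : forall x y, mset x -> mset y -> mset (x * y) }.

Section Fractions.
Variables (A : comPzRingType) (W : mulset A).

Record frac := Frac { num : A; den : A; denP : W den }.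

HB.instance Definition _ := gen_eqMixin frac.
HB.instance Definition _ := gen_choiceMixin frac.

Definition frac_eq (x y : frac) : bool :=
  `[< exists2 u, W u & u * (num x * den y) = u * (num y * den x) >].

Lemma frac_eq_refl : reflexive frac_eq.
Proof. by move=> x; apply/asboolP; exists 1 => //; exact: mset1. Qed.

Lemma frac_eq_sym : symmetric frac_eq.
Proof.
by move=> x y; apply/asboolP/asboolP => -[u Wu e]; exists u.
Qed.

Lemma frac_eq_trans : transitive frac_eq.
Proof.
move=> y x z /asboolP[u Wu e] /asboolP[v Wv e']; apply/asboolP.
exists (u * v * den y); first by apply: msetM; [exact: msetM|exact: denP].
ring: e e'.
Qed.

Canonical frac_equiv := EquivRel frac_eq frac_eq_refl frac_eq_sym frac_eq_trans.

Definition loc : Type := {eq_quot frac_equiv}.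
HB.instance Definition _ := Choice.on loc.

Definition mkloc (x : frac) : loc := \pi_({eq_quot frac_equiv}) x.

Lemma mklocP (x y : frac) :
  mkloc x = mkloc y <-> exists2 u, W u & u * (num x * den y) = u * (num y * den x).
Proof.
split=> [/eqmodP/asboolP//|h].
by apply/eqmodP/asboolP.
Qed.

Definition loc_repr (x : loc) : frac := repr (x : {eq_quot frac_equiv}).

Lemma loc_reprK x : mkloc (loc_repr x) = x.
Proof. exact: reprK. Qed.

Lemma locW (P : loc -> Prop) : (forall x, P (mkloc x)) -> forall x, P x.
Proof. by move=> h x; rewrite -(loc_reprK x). Qed.

Definition frac_of (r : A) : frac := Frac r (mset1 W).
Definition frac_opp (x : frac) : frac := Frac (- num x) (denP x).
Definition frac_add (x y : frac) : frac :=
  Frac (num x * den y + num y * den x) (msetM (denP x) (denP y)).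
Definition frac_mul (x y : frac) : frac :=
  Frac (num x * num y) (msetM (denP x) (denP y)).

Definition loc_opp (x : loc) : loc := mkloc (frac_opp (loc_repr x)).
Definition loc_add (x y : loc) : loc := mkloc (frac_add (loc_repr x) (loc_repr y)).
Definition loc_mul (x y : loc) : loc := mkloc (frac_mul (loc_repr x) (loc_repr y)).

Lemma mkloc_opp x : loc_opp (mkloc x) = mkloc (frac_opp x).
Proof.
have /mklocP[u Wu e] := loc_reprK (mkloc x).
by apply/mklocP; exists u => //=; ring: e.
Qed.

Lemma mkloc_add x y : loc_add (mkloc x) (mkloc y) = mkloc (frac_add x y).
Proof.
have /mklocP[u Wu e] := loc_reprK (mkloc x).
have /mklocP[v Wv e'] := loc_reprK (mkloc y).
by apply/mklocP; exists (u * v) => /=; [exact: msetM|ring: e e'].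
Qed.

Lemma mkloc_mul x y : loc_mul (mkloc x) (mkloc y) = mkloc (frac_mul x y).
Proof.
have /mklocP[u Wu e] := loc_reprK (mkloc x).
have /mklocP[v Wv e'] := loc_reprK (mkloc y).
by apply/mklocP; exists (u * v) => /=; [exact: msetM|ring: e e'].
Qed.

Let eq_loc (x y : frac) : num x * den y = num y * den x -> mkloc x = mkloc y.
Proof. by move=> e; apply/mklocP; exists 1; [exact: mset1|rewrite e]. Qed.

Let loc_addA : associative loc_add.
Proof.
elim/locW=> x; elim/locW=> y; elim/locW=> z.
by rewrite !mkloc_add; apply: eq_loc => /=; ring.
Qed.

Let loc_addC : commutative loc_add.
Proof.
elim/locW=> x; elim/locW=> y.
by rewrite !mkloc_add; apply: eq_loc => /=; ring.
Qed.

Let loc_add0 : left_id (mkloc (frac_of 0)) loc_add.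
Proof. by elim/locW=> x; rewrite mkloc_add; apply: eq_loc => /=; ring. Qed.

Let loc_addN : left_inverse (mkloc (frac_of 0)) loc_opp loc_add.
Proof.
by elim/locW=> x; rewrite mkloc_opp mkloc_add; apply: eq_loc => /=; ring.
Qed.

HB.instance Definition _ :=
  GRing.isZmodule.Build loc loc_addA loc_addC loc_add0 loc_addN.

Let loc_mulA : associative loc_mul.
Proof.
elim/locW=> x; elim/locW=> y; elim/locW=> z.
by rewrite !mkloc_mul; apply: eq_loc => /=; ring.
Qed.

Let loc_mulC : commutative loc_mul.
Proof.
elim/locW=> x; elim/locW=> y.
by rewrite !mkloc_mul; apply: eq_loc => /=; ring.
Qed.

Let loc_mul1 : left_id (mkloc (frac_of 1)) loc_mul.
Proof. by elim/locW=> x; rewrite mkloc_mul; apply: eq_loc => /=; ring. Qed.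

Let loc_mulDl : left_distributive loc_mul +%R.
Proof.
elim/locW=> x; elim/locW=> y; elim/locW=> z.
rewrite -[mkloc x + mkloc y]/(loc_add _ _) mkloc_add !mkloc_mul.
rewrite -[RHS]/(loc_add _ _) mkloc_add.
by apply: eq_loc => /=; ring.
Qed.

HB.instance Definition _ :=
  GRing.Zmodule_isComPzRing.Build loc loc_mulA loc_mulC loc_mul1 loc_mulDl.

Definition loc_in (r : A) : loc := mkloc (frac_of r).

Let loc_in_zmod : zmod_morphism loc_in.
Proof.
move=> x y; rewrite -[RHS]/(loc_add _ (loc_opp _)) mkloc_opp mkloc_add.
by apply: eq_loc => /=; ring.
Qed.

Let loc_in_monoid : monoid_morphism loc_in.
Proof.
split=> // x y; rewrite -[RHS]/(loc_mul _ _) mkloc_mul.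
by apply: eq_loc => /=; ring.
Qed.

HB.instance Definition _ := GRing.isZmodMorphism.Build A loc loc_in loc_in_zmod.
HB.instance Definition _ := GRing.isMonoidMorphism.Build A loc loc_in loc_in_monoid.

Lemma mklocE (x : frac) : mkloc x * loc_in (den x) = loc_in (num x).
Proof.
by rewrite -[LHS]/(loc_mul _ _) mkloc_mul; apply: eq_loc => /=; ring.
Qed.

Lemma loc_in_unit w : W w -> exists v, loc_in w * v = 1.
Proof.
move=> Ww; exists (mkloc (Frac 1 Ww)).
by rewrite mulrC -[w in loc_in w]/(den (Frac 1 Ww)) mklocE.
Qed.

End Fractions.

Arguments loc {A} W.
Arguments loc_in {A} W r.

(* The ring morphism from the ring of fractions induced by a morphism sending the
   denominators to invertible elements. *)
Section LocLift.
Variables (A B : comPzRingType) (W : mulset A) (f : {rmorphism A -> B}).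
Hypothesis fW : forall w, W w -> exists v, f w * v = 1.

Definition loc_lift (x : loc W) : B :=
  f (num (loc_repr x)) * projT1 (cid (fW (denP (loc_repr x)))).

Lemma loc_lift_mk (x : frac W) : loc_lift (mkloc x) * f (den x) = f (num x).
Proof.
rewrite /loc_lift; case: cid => v /= ev.
have /mklocP[u /fW[u' eu] /(congr1 f)] := loc_reprK (mkloc x).
rewrite !rmorphM; set n := f (num (loc_repr _)); set d := f (den (loc_repr _)).
move=> e; rewrite -[LHS]mul1r -[RHS]mul1r -eu.
transitivity (u' * v * (f u * (n * f (den x)))); first by ring.
rewrite e; transitivity (f u * u' * f (num x) * (d * v)); first by ring.
by rewrite ev mulr1.
Qed.

Lemma loc_lift_eq (x : frac W) (b : B) :
  b * f (den x) = f (num x) -> loc_lift (mkloc x) = b.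
Proof.
rewrite -loc_lift_mk => e.
have [v ev] := fW (denP x).
by rewrite -[LHS]mulr1 -[RHS]mulr1 -ev !mulrA e.
Qed.

Let loc_lift_zmod : zmod_morphism loc_lift.
Proof.
elim/locW=> x; elim/locW=> y.
rewrite -[mkloc x - mkloc y]/(loc_add _ (loc_opp _)) mkloc_opp mkloc_add.
apply: loc_lift_eq => /=; rewrite rmorphD !rmorphM rmorphN.
by rewrite -!loc_lift_mk; ring.
Qed.

Let loc_lift_monoid : monoid_morphism loc_lift.
Proof.
split=> [|x y]; first by apply: loc_lift_eq; rewrite /= mul1r.
elim/locW: x => x; elim/locW: y => y.
rewrite -[mkloc x * mkloc y]/(loc_mul _ _) mkloc_mul.
by apply: loc_lift_eq => /=; rewrite !rmorphM -!loc_lift_mk; ring.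
Qed.

HB.instance Definition _ := GRing.isZmodMorphism.Build (loc W) B loc_lift loc_lift_zmod.
HB.instance Definition _ :=
  GRing.isMonoidMorphism.Build (loc W) B loc_lift loc_lift_monoid.

Lemma loc_lift_in (r : A) : loc_lift (loc_in W r) = f r.
Proof. by apply: loc_lift_eq => /=; rewrite rmorph1 mulr1. Qed.

Lemma loc_lift_uniq (g : {rmorphism loc W -> B}) :
  (forall r, g (loc_in W r) = f r) -> g =1 loc_lift.
Proof.
move=> gf; elim/locW=> x; apply/esym/loc_lift_eq.
by rewrite -!gf -rmorphM mklocE.
Qed.

End LocLift.

Section PrimeLoc.
Variables (A : comPzRingType) (p : spec A).

Let compl1 : (~` spec_set p) 1.
Proof. by have [] := specP p. Qed.

Let complM x y : (~` spec_set p) x -> (~` spec_set p) y -> (~` spec_set p) (x * y).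
Proof. by move=> nx ny pxy; have [_ _ /(_ _ _ pxy)[]] := specP p. Qed.

Definition prime_compl : mulset A := MulSet compl1 complM.

Definition loc_at : comPzRingType := loc prime_compl.

End PrimeLoc.

Section Depiction.
Variables (R S : comPzRingType) (phi : {rmorphism R -> S}).

Lemma loc_at_map_unit (q : spec S) (w : R) : prime_compl (spec_map phi q) w ->
  exists v, (loc_in (prime_compl q) \o phi) w * v = 1.
Proof. by move=> /= qw; exact: loc_in_unit. Qed.

Definition loc_at_map (q : spec S) :
    {rmorphism loc_at (spec_map phi q) -> loc_at q} :=
  loc_lift (@loc_at_map_unit q).

(* For an extension R of S of integral domains, both local rings lie in Frac S and
   the canonical map between them is the inclusion: they are equal exactly when
   this map is bijective. *)
Definition U_locus : set (spec S) :=
  [set n | Max n /\ bijective (loc_at_map n)].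

Definition noetherian_locus : set (spec S) :=
  [set n | Max n /\ noetherian (loc_at (spec_map phi n))].

(* [eta] is the k-algebra structure of R, and [phi] the inclusion of R in S. *)
Definition depiction (k : fieldType) (eta : {rmorphism k -> R}) : Prop :=
  [/\ integral_domain S, finitely_generated (phi \o eta : {rmorphism k -> S}),
      injective phi, (forall p : spec R, exists q : spec S, spec_map phi q = p) &
      U_locus = noetherian_locus /\ U_locus !=set0].

End Depiction.

Lemma prime_avoidance (A : comPzRingType) (W : mulset A) (I : set A) :
  ideal I -> (forall w, W w -> ~ I w) ->
  exists p : spec A, I `<=` spec_set p /\ forall w, W w -> ~ p w.
Proof.
move=> iI IW.
pose P (X : set A) :=
  X = set0 \/ [/\ ideal X, I `<=` X & forall w, W w -> ~ X w].
have [F FP Ftot|M [PM Mmax]] := @Zorn_bigcup A P.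
  have [[X [FX X0]]|F0] := pselect (exists X, F X /\ X <> set0); last first.
    left; apply/seteqP; split=> // x [X FX Xx]; apply: F0; exists X; split=> //.
    by move=> X0; rewrite X0 in Xx.
  right; have [//|[iX IX XW]] := FP _ FX; split.
  - split=> [|x y [Y FY Yx] [Z FZ Zy]|a x [Y FY Yx]].
    + by exists X => //; case: iX.
    + have [YZ|ZY] := Ftot _ _ FY FZ.
        have [Z0|[[_ ZD _] _ _]] := FP _ FZ; first by rewrite Z0 in Zy.
        by exists Z => //; apply: ZD => //; exact: YZ.
      have [Y0|[[_ YD _] _ _]] := FP _ FY; first by rewrite Y0 in Yx.
      by exists Y => //; apply: YD => //; exact: ZY.
    + have [Y0|[[_ _ YM] _ _]] := FP _ FY; first by rewrite Y0 in Yx.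
      by exists Y => //; exact: YM.
  - by move=> x Ix; exists X => //; exact: IX.
  - move=> w Ww [Y FY Yw]; have [Y0|[_ _ /(_ _ Ww)//]] := FP _ FY.
    by rewrite Y0 in Yw.
case: PM => [M0|[iM IM MW]].
  case: (Mmax I); last by right; split.
  by rewrite M0; split=> // /(_ 0); apply; case: iI.
have [M0 MD MM] := iM.
have meet x : ~ M x -> exists w a m, [/\ W w, M m & w = m + a * x].
  move=> nMx; apply: contrapT => nex.
  pose N := [set z | exists a m, M m /\ z = m + a * x].
  have NM : M `<=` N by move=> m Mm; exists 0, m; rewrite mul0r addr0.
  apply: (Mmax N).
    split=> // /(_ x) Mx; apply/nMx/Mx.
    by exists 1, 0; split=> //; ring.
  right; split.
  - split=> [|_ _ [a [m [Mm ->]]] [b [n [Mn ->]]]|c _ [a [m [Mm ->]]]].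
    + by exists 0, 0; split=> //; ring.
    + by exists (a + b), (m + n); split; [exact: MD|ring].
    + by exists (c * a), (c * m); split; [exact: MM|ring].
  - by move=> z /IM/NM.
  - move=> w Ww [a [m [Mm e]]]; apply: nex; by exists w, a, m.
have pM : prime_ideal M.
  split=> // [M1|x y Mxy]; first exact: (MW 1 (mset1 W)).
  apply: contrapT => /not_orP[/meet[w [a [m [Ww Mm ew]]]]].
  move=> /meet[w' [b [n [Ww' Mn ew']]]].
  apply: (MW _ (msetM Ww Ww')).
  have -> : w * w' = (n + b * y) * m + (a * x * n + a * b * (x * y)).
    by rewrite ew ew'; ring.
  by apply: (MD); [exact: MM|apply: MD; exact: MM].
by exists (Spec pM).
Qed.

Section Powers.
Variables (A : comPzRingType) (a : A).

Definition is_power : set A := [set x | exists n, x = a ^+ n].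

Lemma is_power1 : is_power 1.
Proof. by exists 0; rewrite expr0. Qed.

Lemma is_powerM x y : is_power x -> is_power y -> is_power (x * y).
Proof. by move=> [m ->] [n ->]; exists (m + n)%N; rewrite exprD. Qed.

Definition powers : mulset A := MulSet is_power1 is_powerM.

Definition inv_ring : comPzRingType := loc powers.

End Powers.

Section Restriction.
Variables (A : comPzRingType) (a b : A).
Hypothesis ba : D b `<=` D a.

Lemma principal_open_sub : exists n c, b ^+ n = c * a.
Proof.
apply: contrapT => nex.
have [|w [n ->] [c bn]|p [ap bp]] :=
  @prime_avoidance A (powers b) [set x | exists c, x = c * a].
- split=> [|_ _ [c ->] [d ->]|c _ [d ->]].
  + by exists 0; rewrite mul0r.
  + by exists (c + d); rewrite mulrDl.
  + by exists (c * d); rewrite mulrA.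
- by apply: nex; exists n, c.
- apply: (ba (t := p)) => /=; first by apply: bp; exists 1%N.
  by apply: ap; exists 1; rewrite mul1r.
Qed.

Lemma powers_unit w : powers a w -> exists v, loc_in (powers b) w * v = 1.
Proof.
move=> [m ->]; have [n [c e]] := principal_open_sub.
have [|v ev] := @loc_in_unit _ (powers b) (b ^+ n ^+ m).
  by exists (n * m)%N; rewrite exprM.
exists (loc_in (powers b) (c ^+ m) * v).
by rewrite mulrA -rmorphM -exprMn mulrC [a * c]mulrC -e mulrC.
Qed.

Definition inv_ring_res : {rmorphism inv_ring a -> inv_ring b} :=
  loc_lift powers_unit.

Lemma inv_ring_res_in r :
  inv_ring_res (loc_in (powers a) r) = loc_in (powers b) r.
Proof. exact: loc_lift_in. Qed.

End Restriction.

(* An element of S (x)_R T is represented by a formal sum of pure tensors s (x) t;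
   two formal sums are identified when all R-balanced biadditive maps agree on
   them.  The universal property is [tens_lift_pure] and [tens_lift_uniq]. *)
Section Tensor.
Variables (R S T : comPzRingType) (f : {rmorphism R -> S}) (g : {rmorphism R -> T}).
Implicit Types (l : seq (S * T)) (P : zmodType).

Definition balanced P (beta : S -> T -> P) : Prop :=
  [/\ forall s s' t, beta (s + s') t = beta s t + beta s' t,
      forall s t t', beta s (t + t') = beta s t + beta s t' &
      forall r s t, beta (f r * s) t = beta s (g r * t)].

Definition formal_eval P (beta : S -> T -> P) l : P :=
  \sum_(x <- l) beta x.1 x.2.

Definition formal_eq l l' : bool :=
  `[< forall P (beta : S -> T -> P),
        balanced beta -> formal_eval beta l = formal_eval beta l' >].

Lemma formal_eq_refl : reflexive formal_eq.
Proof. by move=> l; apply/asboolP. Qed.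

Lemma formal_eq_sym : symmetric formal_eq.
Proof. by move=> l l'; apply/asboolP/asboolP => e P beta /e ->. Qed.

Lemma formal_eq_trans : transitive formal_eq.
Proof.
move=> l l1 l2 /asboolP e /asboolP e'; apply/asboolP => P beta bal.
by rewrite e // e'.
Qed.

Canonical formal_equiv :=
  EquivRel formal_eq formal_eq_refl formal_eq_sym formal_eq_trans.

Definition tensor : Type := {eq_quot formal_equiv}.
HB.instance Definition _ := Choice.on tensor.

Definition mktens l : tensor := \pi_({eq_quot formal_equiv}) l.
Definition tens_repr (x : tensor) : seq (S * T) := repr (x : {eq_quot formal_equiv}).

Lemma mktensP l l' : mktens l = mktens l' <->
  forall P (beta : S -> T -> P),
    balanced beta -> formal_eval beta l = formal_eval beta l'.
Proof. by split=> [/eqmodP/asboolP//|h]; apply/eqmodP/asboolP. Qed.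

Lemma tens_reprK x : mktens (tens_repr x) = x.
Proof. exact: reprK. Qed.

Lemma tensW (Q : tensor -> Prop) : (forall l, Q (mktens l)) -> forall x, Q x.
Proof. by move=> h x; rewrite -(tens_reprK x). Qed.

Definition formal_opp l := [seq (- x.1, x.2) | x <- l].
Definition formal_mul l l' := [seq (x.1 * y.1, x.2 * y.2) | x <- l, y <- l'].

Lemma formal_eval_cat P (beta : S -> T -> P) l l' :
  formal_eval beta (l ++ l') = formal_eval beta l + formal_eval beta l'.
Proof. exact: big_cat. Qed.

Lemma balanced_oppl P (beta : S -> T -> P) s t :
  balanced beta -> beta (- s) t = - beta s t.
Proof.
move=> [bl _ _]; apply: (addIr (beta s t)); rewrite -bl !addNr.
by apply: (addIr (beta 0 t)); rewrite -bl !add0r.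
Qed.

Lemma formal_eval_opp P (beta : S -> T -> P) l : balanced beta ->
  formal_eval beta (formal_opp l) = - formal_eval beta l.
Proof.
move=> bal; rewrite /formal_eval big_map -sumrN.
by apply: eq_bigr => x _; exact: balanced_oppl.
Qed.

Lemma formal_eval_mul P (beta : S -> T -> P) l l' :
  formal_eval beta (formal_mul l l') =
  \sum_(x <- l) \sum_(y <- l') beta (x.1 * y.1) (x.2 * y.2).
Proof. by rewrite /formal_eval big_allpairs_dep. Qed.

Lemma balanced_mul P (beta : S -> T -> P) l : balanced beta ->
  balanced (fun s t => \sum_(y <- l) beta (s * y.1) (t * y.2)).
Proof.
move=> [bl br bm]; split=> [s s' t|s t t'|r s t].
- by rewrite -big_split; apply: eq_bigr => y _; rewrite mulrDl bl.
- by rewrite -big_split; apply: eq_bigr => y _; rewrite mulrDl br.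
- by apply: eq_bigr => y _; rewrite -!mulrA bm.
Qed.

Lemma formal_mulC l l' : mktens (formal_mul l l') = mktens (formal_mul l' l).
Proof.
apply/mktensP => P beta bal; rewrite !formal_eval_mul exchange_big /=.
by apply: eq_bigr => x _; apply: eq_bigr => y _; rewrite mulrC [X in beta _ X]mulrC.
Qed.

Definition tens_opp (x : tensor) : tensor := mktens (formal_opp (tens_repr x)).
Definition tens_add (x y : tensor) : tensor := mktens (tens_repr x ++ tens_repr y).
Definition tens_mul (x y : tensor) : tensor :=
  mktens (formal_mul (tens_repr x) (tens_repr y)).

Lemma mktens_opp l : tens_opp (mktens l) = mktens (formal_opp l).
Proof.
apply/mktensP => P beta bal; rewrite !formal_eval_opp //.
by have /mktensP -> := tens_reprK (mktens l).
Qed.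

Lemma mktens_add l l' : tens_add (mktens l) (mktens l') = mktens (l ++ l').
Proof.
apply/mktensP => P beta bal; rewrite !formal_eval_cat.
have /mktensP -> // := tens_reprK (mktens l).
by have /mktensP -> := tens_reprK (mktens l').
Qed.

Lemma mktens_mul l l' : tens_mul (mktens l) (mktens l') = mktens (formal_mul l l').
Proof.
have congl l1 l2 l3 : mktens l1 = mktens l2 ->
    mktens (formal_mul l1 l3) = mktens (formal_mul l2 l3).
  move=> /mktensP e; apply/mktensP => P beta bal; rewrite !formal_eval_mul.
  exact: (e _ _ (balanced_mul l3 bal)).
rewrite /tens_mul (congl _ l); last exact: tens_reprK.
by rewrite formal_mulC (congl _ l') 1?formal_mulC //; exact: tens_reprK.
Qed.

Let tens_addA : associative tens_add.
Proof.
by elim/tensW=> x; elim/tensW=> y; elim/tensW=> z; rewrite !mktens_add catA.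
Qed.

Let tens_addC : commutative tens_add.
Proof.
elim/tensW=> x; elim/tensW=> y; rewrite !mktens_add.
by apply/mktensP => P beta _; rewrite !formal_eval_cat addrC.
Qed.

Let tens_add0 : left_id (mktens [::]) tens_add.
Proof. by elim/tensW=> x; rewrite mktens_add. Qed.

Let tens_addN : left_inverse (mktens [::]) tens_opp tens_add.
Proof.
elim/tensW=> x; rewrite mktens_opp mktens_add; apply/mktensP => P beta bal.
by rewrite formal_eval_cat formal_eval_opp // addNr /formal_eval big_nil.
Qed.

HB.instance Definition _ :=
  GRing.isZmodule.Build tensor tens_addA tens_addC tens_add0 tens_addN.

Let tens_mulA : associative tens_mul.
Proof.
elim/tensW=> x; elim/tensW=> y; elim/tensW=> z; rewrite !mktens_mul.
apply/mktensP => P beta bal.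
rewrite formal_eval_mul /formal_mul /formal_eval !big_allpairs_dep /=.
apply: eq_bigr => u _; rewrite big_allpairs_dep; apply: eq_bigr => v _.
by apply: eq_bigr => w _; rewrite !mulrA.
Qed.

Let tens_mulC : commutative tens_mul.
Proof. by elim/tensW=> x; elim/tensW=> y; rewrite !mktens_mul formal_mulC. Qed.

Let tens_mul1 : left_id (mktens [:: (1, 1)]) tens_mul.
Proof.
elim/tensW=> x; rewrite mktens_mul /formal_mul /= cats0; congr mktens.
by rewrite -[RHS]map_id; apply: eq_map => -[s t] /=; rewrite !mul1r.
Qed.

Let tens_mulDl : left_distributive tens_mul +%R.
Proof.
elim/tensW=> x; elim/tensW=> y; elim/tensW=> z.
rewrite -[mktens x + mktens y]/(tens_add _ _) mktens_add !mktens_mul.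
by rewrite -[RHS]/(tens_add _ _) mktens_add /formal_mul allpairs_cat.
Qed.

HB.instance Definition _ :=
  GRing.Zmodule_isComPzRing.Build tensor tens_mulA tens_mulC tens_mul1 tens_mulDl.

Definition pure (s : S) (t : T) : tensor := mktens [:: (s, t)].

Lemma pure_balanced : balanced pure.
Proof.
split=> [s s' t|s t t'|r s t]; rewrite -?[RHS]/(tens_add _ _) ?mktens_add;
  apply/mktensP => P beta [bl br bm]; rewrite /formal_eval !big_cons !big_nil /=.
- by rewrite bl !addr0.
- by rewrite br !addr0.
- by rewrite bm.
Qed.

Lemma mktensE l : mktens l = \sum_(x <- l) pure x.1 x.2.
Proof.
elim: l => [|[s t] l IH]; first by rewrite big_nil.
by rewrite big_cons -IH -[RHS]/(tens_add _ _) mktens_add.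
Qed.

Section Lift.
Variables (P : zmodType) (beta : S -> T -> P).
Definition tens_lift (_ : balanced beta) (x : tensor) : P := formal_eval beta (tens_repr x).

Hypothesis bal : balanced beta.

Lemma tens_lift_mk l : tens_lift bal (mktens l) = formal_eval beta l.
Proof. by have /mktensP := tens_reprK (mktens l); exact. Qed.

Let tens_lift_zmod : zmod_morphism (tens_lift bal).
Proof.
elim/tensW=> x; elim/tensW=> y.
rewrite -[mktens x - mktens y]/(tens_add _ (tens_opp _)) mktens_opp mktens_add.
by rewrite !tens_lift_mk formal_eval_cat formal_eval_opp.
Qed.

HB.instance Definition _ :=
  GRing.isZmodMorphism.Build tensor P (tens_lift bal) tens_lift_zmod.

Lemma tens_lift_pure s t : tens_lift bal (pure s t) = beta s t.
Proof. by rewrite tens_lift_mk /formal_eval big_seq1. Qed.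

Lemma tens_lift_uniq (h : {additive tensor -> P}) :
  (forall s t, h (pure s t) = beta s t) -> h =1 tens_lift bal.
Proof.
move=> hE; elim/tensW=> l; rewrite tens_lift_mk mktensE raddf_sum.
by apply: eq_bigr => x _; exact: hE.
Qed.

End Lift.

Let pureE s t s' t' : pure s t * pure s' t' = pure (s * s') (t * t').
Proof. by rewrite -[LHS]/(tens_mul _ _) mktens_mul. Qed.

Definition tens_inr (t : T) : tensor := pure 1 t.

Let tens_inr_zmod : zmod_morphism tens_inr.
Proof.
have [_ br _] := pure_balanced => t t'.
by apply: (addIr (tens_inr t')); rewrite subrK -br subrK.
Qed.

Let tens_inr_monoid : monoid_morphism tens_inr.
Proof. by split=> // t t'; rewrite pureE mulr1. Qed.

HB.instance Definition _ := GRing.isZmodMorphism.Build T tensor tens_inr tens_inr_zmod.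
HB.instance Definition _ :=
  GRing.isMonoidMorphism.Build T tensor tens_inr tens_inr_monoid.

End Tensor.

Section TensorMap.
Variables (R S T T' : comPzRingType).
Variables (f : {rmorphism R -> S}) (g : {rmorphism R -> T}).
Variables (g' : {rmorphism R -> T'}) (h : {rmorphism T -> T'}).

Definition tens_map (_ : forall r, h (g r) = g' r) (x : tensor f g) : tensor f g' :=
  mktens f g' [seq (y.1, h y.2) | y <- tens_repr x].

Hypothesis hg : forall r, h (g r) = g' r.

Lemma tens_map_mk l :
  tens_map hg (mktens f g l) = mktens f g' [seq (y.1, h y.2) | y <- l].
Proof.
apply/mktensP => P beta [bl br bm]; rewrite /formal_eval !big_map /=.
have bal : balanced f g (fun s t => beta s (h t)).
  by split=> [s s' t|s t t'|r s t] /=; rewrite ?rmorphD ?rmorphM ?hg.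
by have /mktensP/(_ _ _ bal) := tens_reprK (mktens f g l).
Qed.

Let tens_map_zmod : zmod_morphism (tens_map hg).
Proof.
elim/tensW=> x; elim/tensW=> y.
rewrite -[mktens f g x - mktens f g y]/(tens_add _ (tens_opp _)).
rewrite mktens_opp mktens_add !tens_map_mk -[RHS]/(tens_add _ (tens_opp _)).
by rewrite mktens_opp mktens_add map_cat /formal_opp -!map_comp.
Qed.

Let tens_map_monoid : monoid_morphism (tens_map hg).
Proof.
split=> [|x y]; first by rewrite tens_map_mk /= rmorph1.
elim/tensW: x => x; elim/tensW: y => y.
rewrite -[mktens f g x * mktens f g y]/(tens_mul _ _) mktens_mul !tens_map_mk.
rewrite -[RHS]/(tens_mul _ _) mktens_mul; congr mktens.
rewrite /formal_mul map_allpairs allpairs_mapl allpairs_mapr.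
by apply: eq_allpairs => u v; rewrite /= rmorphM.
Qed.

HB.instance Definition _ :=
  GRing.isZmodMorphism.Build (tensor f g) (tensor f g') (tens_map hg) tens_map_zmod.
HB.instance Definition _ :=
  GRing.isMonoidMorphism.Build (tensor f g) (tensor f g') (tens_map hg) tens_map_monoid.

Lemma tens_map_pure s t : tens_map hg (pure f g s t) = pure f g' s (h t).
Proof. exact: tens_map_mk. Qed.

End TensorMap.

Arguments tens_map {R S T T'} f {g g' h} hg x.

Record opens (X : topologicalType) := Opens {
  open_set :> set X;
  openP : open open_set }.

Definition opensI (X : topologicalType) (U V : opens X) : opens X :=
  Opens (openI (openP U) (openP V)).

Section Presheaf.
Variable X : topologicalType.

Record presheaf := Presheaf {
  sections :> opens X -> comPzRingType;
  restr : forall U V : opens X, V `<=` U -> {rmorphism sections U -> sections V};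
  restr_id : forall (U : opens X) (UU : U `<=` U) (s : sections U), restr UU s = s;
  restr_comp : forall (U V W : opens X) (VU : V `<=` U) (WV : W `<=` V)
    (WU : W `<=` U) (s : sections U), restr WV (restr VU s) = restr WU s }.

Record presheaf_morphism (F G : presheaf) := PresheafMorphism {
  pmor :> forall U : opens X, {rmorphism F U -> G U};
  pmor_natural : forall (U V : opens X) (VU : V `<=` U) (s : F U),
    pmor V (restr F VU s) = restr G VU (pmor U s) }.

Definition sheaf (F : presheaf) : Prop :=
  forall (I : Type) (U : I -> opens X) (V : opens X) (UV : forall i, U i `<=` V),
    V `<=` \bigcup_i U i ->
    forall s : forall i, F (U i),
      (forall i j, restr F (@subIsetl _ (U i) (U j) : opensI (U i) (U j) `<=` U i) (s i)
                 = restr F (@subIsetr _ (U i) (U j) : opensI (U i) (U j) `<=` U j) (s j)) ->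
      exists! t : F V, forall i, restr F (UV i) t = s i.

End Presheaf.


(* The inverse limits of the rings F(a), over the principal open sets D(a)
   contained in U. *)
Section Limit.
Variables (R : comPzRingType) (F : R -> comPzRingType).
Variable rho : forall a b : R, D b `<=` D a -> {rmorphism F a -> F b}.

Section LimitRing.
Variable U : set (spec R).

Record limit := Limit {
  lfam :> forall a, D a `<=` U -> F a;
  lfam_compat : forall a b (aU : D a `<=` U) (bU : D b `<=` U) (ba : D b `<=` D a),
    rho ba (lfam aU) = lfam bU }.

Lemma limit_eq (x y : limit) : (forall a (aU : D a `<=` U), x a aU = y a aU) -> x = y.
Proof.
case: x y => [x xc] [y yc] /= e.
have exy : x = y by do 2!apply: functional_extensionality_dep => ?; exact: e.
by case: _ / exy yc => yc; congr Limit; exact: Prop_irrelevance.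
Qed.

HB.instance Definition _ := gen_eqMixin limit.
HB.instance Definition _ := gen_choiceMixin limit.

Definition limit_zero : limit.
Proof. by exists (fun a _ => 0) => a b *; rewrite rmorph0. Defined.

Definition limit_one : limit.
Proof. by exists (fun a _ => 1) => a b *; rewrite rmorph1. Defined.

Definition limit_opp (x : limit) : limit.
Proof.
by exists (fun a aU => - x a aU) => a b aU bU ba; rewrite rmorphN lfam_compat.
Defined.

Definition limit_add (x y : limit) : limit.
Proof.
exists (fun a aU => x a aU + y a aU) => a b aU bU ba.
by rewrite rmorphD !lfam_compat.
Defined.

Definition limit_mul (x y : limit) : limit.
Proof.
exists (fun a aU => x a aU * y a aU) => a b aU bU ba.
by rewrite rmorphM !lfam_compat.
Defined.

Let limit_addA : associative limit_add.
Proof. by move=> x y z; apply: limit_eq => a aU /=; rewrite addrA. Qed.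

Let limit_addC : commutative limit_add.
Proof. by move=> x y; apply: limit_eq => a aU /=; rewrite addrC. Qed.

Let limit_add0 : left_id limit_zero limit_add.
Proof. by move=> x; apply: limit_eq => a aU /=; rewrite add0r. Qed.

Let limit_addN : left_inverse limit_zero limit_opp limit_add.
Proof. by move=> x; apply: limit_eq => a aU /=; rewrite addNr. Qed.

HB.instance Definition _ :=
  GRing.isZmodule.Build limit limit_addA limit_addC limit_add0 limit_addN.

Let limit_mulA : associative limit_mul.
Proof. by move=> x y z; apply: limit_eq => a aU /=; rewrite mulrA. Qed.

Let limit_mulC : commutative limit_mul.
Proof. by move=> x y; apply: limit_eq => a aU /=; rewrite mulrC. Qed.

Let limit_mul1 : left_id limit_one limit_mul.
Proof. by move=> x; apply: limit_eq => a aU /=; rewrite mul1r. Qed.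

Let limit_mulDl : left_distributive limit_mul +%R.
Proof. by move=> x y z; apply: limit_eq => a aU /=; rewrite mulrDl. Qed.

HB.instance Definition _ := GRing.Zmodule_isComPzRing.Build limit
  limit_mulA limit_mulC limit_mul1 limit_mulDl.

End LimitRing.

Section LimitRestr.
Variables (U V : set (spec R)) (VU : V `<=` U).

Definition limit_restr (x : limit U) : limit V.
Proof.
exists (fun a aV => x a (subset_trans aV VU)) => a b aV bV ba.
exact: lfam_compat.
Defined.

Let limit_restr_zmod : zmod_morphism limit_restr.
Proof. by move=> x y; apply: limit_eq. Qed.

Let limit_restr_monoid : monoid_morphism limit_restr.
Proof. by split=> [|x y]; apply: limit_eq. Qed.

HB.instance Definition _ :=
  GRing.isZmodMorphism.Build (limit U) (limit V) limit_restr limit_restr_zmod.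
HB.instance Definition _ :=
  GRing.isMonoidMorphism.Build (limit U) (limit V) limit_restr limit_restr_monoid.

End LimitRestr.

Definition limit_presheaf : presheaf (spec R).
Proof.
exists (fun U : opens (spec R) => limit U : comPzRingType)
  (fun U V VU => limit_restr VU : {rmorphism limit U -> limit V}).
- by move=> U UU s; apply: limit_eq => a aU /=; congr (lfam s).
- by move=> U V W VU WV WU s; apply: limit_eq => a aU /=; congr (lfam s).
Defined.

(* The projection of the sections over D(a) onto F(a) is an isomorphism, so that
   [limit_presheaf] does take the value F(a) on D(a). *)
Lemma limit_principal (a : R) :
  (forall aa x, @rho a a aa x = x) ->
  (forall b c ba cb ca x, @rho b c cb (@rho a b ba x) = @rho a c ca x) ->
  bijective (fun x : limit (D a) => x a (@subset_refl _ (D a))).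
Proof.
move=> rho_id rho_comp.
have compat (x : F a) b c (ba : D b `<=` D a) (ca : D c `<=` D a) (cb : D c `<=` D b) :
    rho cb (rho ba x) = rho ca x by exact: rho_comp.
exists (fun x => @Limit (D a) (fun b ba => rho ba x) (compat x)) => x /=.
  by apply: limit_eq => b ba /=; exact: lfam_compat.
exact: rho_id.
Qed.

End Limit.

Lemma inv_ring_res_id (R : comPzRingType) (a : R) (aa : D a `<=` D a) x :
  inv_ring_res aa x = x.
Proof. by apply/esym/(@loc_lift_uniq _ _ _ _ _ idfun). Qed.

Lemma inv_ring_res_comp (R : comPzRingType) (a b c : R) (ba : D b `<=` D a)
    (cb : D c `<=` D b) (ca : D c `<=` D a) x :
  inv_ring_res cb (inv_ring_res ba x) = inv_ring_res ca x.
Proof.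
apply: (@loc_lift_uniq _ _ _ _ _ (inv_ring_res cb \o inv_ring_res ba)) => r /=.
by rewrite !inv_ring_res_in.
Qed.

Definition structure_sheaf (R : comPzRingType) : presheaf (spec R) :=
  limit_presheaf (@inv_ring_res R).

Lemma structure_sheaf_principal (R : comPzRingType) (a : R) :
  bijective (fun x : limit (@inv_ring_res R) (D a) => x a (@subset_refl _ (D a))).
Proof.
apply: limit_principal => [aa x|b c ba cb ca x]; first exact: inv_ring_res_id.
exact: inv_ring_res_comp.
Qed.

Section Sections.
Variables (R : comPzRingType) (U : opens (spec R)).

Definition global_section (r : R) : structure_sheaf R U.
Proof.
exists (fun a _ => loc_in (powers a) r) => a b aU bU ba.
exact: inv_ring_res_in.
Defined.

Let global_section_zmod : zmod_morphism global_section.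
Proof. by move=> x y; apply: limit_eq => a aU /=; rewrite rmorphB. Qed.

Let global_section_monoid : monoid_morphism global_section.
Proof.
split=> [|x y]; apply: limit_eq => a aU /=; first by rewrite rmorph1.
by rewrite rmorphM.
Qed.

HB.instance Definition _ := GRing.isZmodMorphism.Build
  R (structure_sheaf R U) global_section global_section_zmod.
HB.instance Definition _ := GRing.isMonoidMorphism.Build
  R (structure_sheaf R U) global_section global_section_monoid.

End Sections.

Section Sheafification.
Variables (R S : comPzRingType) (phi : {rmorphism R -> S}).

Definition base_change (a : R) : comPzRingType := tensor phi (loc_in (powers a)).

Definition base_change_res (a b : R) (ba : D b `<=` D a) :
    {rmorphism base_change a -> base_change b} :=
  tens_map phi (inv_ring_res_in ba).

(* The sheaf of algebras on Spec R attached to the R-algebra S; as a sheaf of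
   modules it is the one attached to the R-module S. *)
Definition sheafification : presheaf (spec R) := limit_presheaf base_change_res.

Lemma sheafification_principal (a : R) :
  bijective (fun x : limit base_change_res (D a) => x a (@subset_refl _ (D a))).
Proof.
apply: limit_principal => [aa x|b c ba cb ca x]; elim/tensW: x => l.
  rewrite [LHS]tens_map_mk; congr mktens.
  by elim: l => //= -[s t] l ->; rewrite inv_ring_res_id.
have resE u v (vu : D v `<=` D u) l' :
    base_change_res vu (mktens phi (loc_in (powers u)) l') =
    mktens phi (loc_in (powers v)) [seq (y.1, inv_ring_res vu y.2) | y <- l'].
  exact: tens_map_mk.
rewrite !resE; congr mktens.
by elim: l => //= -[s t] l ->; rewrite (inv_ring_res_comp ba cb ca).
Qed.

Section Unit.
Variable U : opens (spec R).

Definition sheafification_unit_fun (x : structure_sheaf R U) : sheafification U.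
Proof.
exists (fun a aU => tens_inr phi (loc_in (powers a)) (x a aU)) => a b aU bU ba.
by rewrite [LHS]tens_map_pure (lfam_compat x).
Defined.

Let sheafification_unit_zmod : zmod_morphism sheafification_unit_fun.
Proof. by move=> x y; apply: limit_eq => a aU; rewrite /= -rmorphB. Qed.

Let sheafification_unit_monoid : monoid_morphism sheafification_unit_fun.
Proof.
split=> [|x y]; apply: limit_eq => a aU; first exact: rmorph1.
by rewrite /= -rmorphM.
Qed.

HB.instance Definition _ := GRing.isZmodMorphism.Build
  (structure_sheaf R U) (sheafification U)
  sheafification_unit_fun sheafification_unit_zmod.
HB.instance Definition _ := GRing.isMonoidMorphism.Build
  (structure_sheaf R U) (sheafification U)
  sheafification_unit_fun sheafification_unit_monoid.

End Unit.

(* On D(a), the map R[1/a] -> S (x)_R R[1/a], x |-> 1 (x) x. *)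
Definition sheafification_unit :
  presheaf_morphism (structure_sheaf R) sheafification.
Proof.
apply: (@PresheafMorphism _ (structure_sheaf R) sheafification
  (fun U => @sheafification_unit_fun U
    : {rmorphism structure_sheaf R U -> sheafification U})) => U V VU x.
by apply: limit_eq.
Defined.

End Sheafification.

Lemma open_principal (R : comPzRingType) (a : R) : open (D a : set (spec R)).
Proof.
rewrite zariski_openE => p pa; exists a; split; first exact: pa.
exact: subset_refl.
Qed.

Definition principal (R : comPzRingType) (a : R) : opens (spec R) :=
  Opens (@open_principal R a).

(* An O-algebra F (with structure morphism [iota]) on Spec R, for a k-algebra R. *)
Definition sheaf_of_depictions (k : fieldType) (R : comPzRingType)
    (eta : {rmorphism k -> R}) (F : presheaf (spec R))
    (iota : presheaf_morphism (structure_sheaf R) F) : Prop :=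
  sheaf F /\
  forall a : R, principal a !=set0 ->
    depiction (iota (principal a))
      (@global_section R (principal a) \o eta
        : {rmorphism k -> structure_sheaf R (principal a)}).

(* Main.v *)
Require Import Defs.
From HB Require Import structures.
From mathcomp Require Import all_boot all_order all_algebra.
From mathcomp Require Import generic_quotient ring_quotient ring.
From mathcomp Require Import boolp classical_sets topology.

(** Two things have to be shown: that [sheafification phi] is a sheaf, and that over
    every nonempty D(a) it is a depiction.

    Both [global_section] : R -> O(D(a)) and [sheafification_section] : S -> S~(D(a))
    are localizations, at a and at phi(a), and they form a commutative square with phi.
    Since D(a) is nonempty and S is a domain containing R, a and phi(a) are not zero.
    So the second claim is that a localization R[1/a] -> S[1/a] of a depiction is a
    depiction ([localized_depiction]).  Being a domain, finite generation,
    injectivity and surjectivity on spectra pass to localizations directly.  For the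
    two loci, let n' be a maximal ideal of S[1/a], lying over n in S.  The local rings
    of R[1/a] and S[1/a] at n' are those of R and S at n, so that both conditions on n'
    (equality of the local rings, noetherianity) are the conditions on n
    ([localized_loc_at], [localized_noetherian]).  The hypothesis speaks of maximal
    ideals only, so n must be maximal: this is where S being finitely generated over
    an algebraically closed field enters, through the Nullstellensatz
    ([contract_maximal]).  The locus is nonempty because it is open: if the local
    rings of R and S agree at n0, then the finitely many generators of S have a common
    denominator t in R outside n0 ([common_denominator]), whence S[1/t] = R[1/t] and
    the local rings agree at every point where t does not vanish.  S[1/a] has such a
    maximal ideal because t is not zero in it ([maximal_avoiding]).

    The Nullstellensatz is obtained from Zariski's lemma in the form due to Goldman and
    Krull: a domain A contained in a field finitely generated as an A-algebra becomes a
    field after inverting one element ([goldman_of_generates]), and polynomial rings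
    never do ([poly_not_goldman]).

    For the sheaf property, all sections over nonempty open sets are fractions of the
    domain S, and restriction between nonempty open sets does not change the fraction.
    Compatible local sections are thus one and the same fraction m/d.  The elements r
    of R with r m/d in S form an ideal; if m/d is locally a section on D(a), this
    ideal lies in no prime of D(a), so it contains a power of a, and m/d is a section
    on D(a) ([represents_local]). *)

Set Implicit Arguments.
Unset Strict Implicit.
Unset Printing Implicit Defensive.

Import GRing.Theory.
Local Open Scope classical_set_scope.
Local Open Scope ring_scope.
Local Open Scope quotient_scope.

(** * Zariski's lemma *)

(** The property of [finitely_generated] with the generators made explicit, for inductions
    on their number. *)
Definition generates (A : pzRingType) (B : comPzRingType) (f : A -> B) (s : seq B) : Prop :=
  forall E : set B,
    (forall c, E (f c)) ->
    (forall x y, E x -> E y -> E (x + y)) ->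
    (forall x y, E x -> E y -> E (x * y)) ->
    (forall x, x \in s -> E x) -> E = setT.

(** The domains A such that A[1/a] is a field for some nonzero a. *)
Definition goldman (A : idomainType) : Prop :=
  exists2 a : A, a != 0 & forall b, b != 0 -> exists N c, b * c = a ^+ N.

(** If A[X][1/f] were a field, then b = 1 + X f would divide a power of f, hence a power
    of X f = b - 1; but b is prime to b - 1 and has positive degree. *)
Lemma poly_not_goldman (A : idomainType) : ~ goldman {poly A}.
Proof.
case=> f f0 h; pose b := 1 + 'X * f.
have sb : (1 < size b)%N.
  rewrite /b addrC size_polyDl ?size_polyC ?oner_eq0 mulrC size_mulX //.
    by rewrite ltnS lt0n size_poly_eq0.
  by rewrite ltnS lt0n size_poly_eq0.
have b0 : b != 0 by rewrite -size_poly_gt0; exact: ltn_trans sb.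
have [N [c e]] := h _ b0.
have eb : 'X * f = b - 1 by rewrite /b addrC addKr.
have : exists u, b * u = (-1) ^+ N.
  have := subrXX (b - 1) (-1) N; rewrite opprK subrK.
  set g := (\sum_(_ < _) _) => eN.
  exists ('X ^+ N * c - g); rewrite mulrBr mulrCA e -exprMn eb -eN.
  by rewrite opprB addrC subrK.
case=> u eu; have : size (b * u) = 1%N.
  by rewrite eu -signr_odd; case: odd; rewrite ?expr1 ?size_polyN size_poly1.
have u0 : u != 0.
  by apply: contra_eq_neq eu => ->; rewrite mulr0 eq_sym signr_eq0.
rewrite size_mul //; move: sb; rewrite -size_poly_gt0 in u0.
by case: (size b) => [|[|m]] //; case: (size u) u0 => [|n] // _ _; rewrite addnS.
Qed.

Section Goldman.
Variables (A : idomainType) (K : fieldType) (f : {rmorphism A -> K}).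
Hypothesis f_inj : injective f.

(** Multiplying an equation of degree n for x by the (n-1)-st power of its leading
    coefficient c gives a monic equation for c x. *)
Lemma algebraic_scaled_integral (p : {poly A}) (x : K) :
  p != 0 -> root (map_poly f p) x -> integralOver f (f (lead_coef p) * x).
Proof.
move=> p0 /rootP px; set c := lead_coef p.
have c0 : c != 0 by rewrite lead_coef_eq0.
case sp: (size p) => [|[|d]]; first by move/eqP: sp; rewrite size_poly_eq0 (negPf p0).
  move/eqP: px; have /eqP/size_poly1P[e e0 ->] := sp.
  by rewrite map_polyC hornerC (raddf_eq0 _ f_inj) (negPf e0).
have cE : c = p`_d.+1 by rewrite /c lead_coefE sp.
(* The coefficients are c^(d - i) p_i for all i; at i = d.+1 this is c^(-1) c = 1. *)
exists (\poly_(i < d.+2) (if i == d.+1 then 1 else p`_i * c ^+ (d - i))).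
  by rewrite monicE lead_coef_poly ?eqxx ?oner_eq0.
apply/rootP; transitivity (f c ^+ d * (map_poly f p).[x]); last by rewrite px mulr0.
rewrite !(@horner_coef_wide _ d.+2) ?size_map_inj_poly ?rmorph0 ?sp ?size_poly //.
rewrite mulr_sumr; apply: eq_bigr => -[i /= lti] _.
rewrite !coef_map /= coef_poly lti; case: eqP => [->|/eqP ni].
  by rewrite (rmorph1 f) -cE exprMn exprS; ring.
have le : (i <= d)%N by move: lti; rewrite ltnS leq_eqVlt (negPf ni).
by rewrite rmorphM rmorphXn exprMn -{2}(subnK le) exprD; ring.
Qed.

(** Let a be the product of the leading coefficients of equations for the generators:
    then every y in K becomes integral over A when multiplied by a power of a.  For
    y = 1/b, clearing denominators in the integral equation shows that b divides a
    power of a. *)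
Lemma goldman_algebraic (xs : seq K) : generates f xs ->
  (forall x, x \in xs -> exists2 p : {poly A}, p != 0 & root (map_poly f p) x) ->
  goldman A.
Proof.
move=> gen alg.
have [a a0 aP] : exists2 a : A, a != 0 &
    forall x, x \in xs -> integralOver f (f a * x).
  elim: xs alg {gen} => [|x xs IH] alg; first by exists 1 => //; exact: oner_neq0.
  have [|a a0 aP] := IH; first by move=> y yxs; apply: alg; rewrite inE yxs orbT.
  have [p p0 px] := alg x (mem_head _ _).
  exists (a * lead_coef p); first by rewrite mulf_neq0 // lead_coef_eq0.
  move=> y; rewrite inE rmorphM => /predU1P[->|/aP iy].
    by rewrite -mulrA; apply/integral_mul/algebraic_scaled_integral => //; exact: integral_id.
  by rewrite mulrAC mulrC; apply: integral_mul => //; exact: integral_id.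
have iX N : integralOver f (f a ^+ N) by rewrite -rmorphXn; exact: integral_id.
have all_int y : exists N, integralOver f (f a ^+ N * y).
  suff : [set y | exists N, integralOver f (f a ^+ N * y)] = setT by move=> /seteqP[_]; apply.
  apply: gen => [c|{}y z [M iy] [N iz]|{}y z [M iy] [N iz]|x /aP ix].
  - by exists 0; rewrite expr0 mul1r; exact: integral_id.
  - exists (M + N)%N; rewrite mulrDr exprD {1}[_ * f a ^+ N]mulrC -!mulrA.
    by apply: integral_add; apply: integral_mul.
  - by exists (M + N)%N; rewrite exprD mulrACA; apply: integral_mul.
  - by exists 1; rewrite expr1.
exists a => // b b0; have [N [p pm /rootP]] := all_int (f b)^-1.
have fb0 : f b != 0 by rewrite (raddf_eq0 _ f_inj).
set y := f a ^+ N * _ => py.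
have yb : f b * y = f (a ^+ N) by rewrite /y mulrCA divff // mulr1 rmorphXn.
have sp : (0 < size p)%N by rewrite size_poly_gt0 monic_neq0.
case ep: (size p) sp => [//|d] _.
pose c := - \sum_(i < d) p`_i * a ^+ N ^+ i * b ^+ (d - i.+1).
exists (N * d)%N, c; apply: f_inj; rewrite exprM.
apply/esym/eqP; rewrite -subr_eq0 -rmorphB; apply/eqP.
transitivity (f b ^+ d * (map_poly f p).[y]); last by rewrite py mulr0.
rewrite (@horner_coef_wide _ d.+1) ?size_map_inj_poly ?rmorph0 ?ep //.
rewrite big_ord_recr /= coef_map /=.
have -> : p`_d = 1 by have := monicP pm; rewrite lead_coefE ep.
rewrite (rmorph1 f) mul1r mulrDr -exprMn yb -rmorphXn [RHS]addrC.
rewrite rmorphB /c mulrN rmorphN opprK; congr (_ + _); first exact: rmorphXn.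
rewrite rmorphM rmorph_sum !mulr_sumr; apply: eq_bigr => -[i /= lti] _.
have -> : b ^+ d = b * b ^+ i * b ^+ (d - i.+1).
  by rewrite -exprS -exprD subnKC.
rewrite coef_map /= !rmorphM (rmorphXn f i (a ^+ N)) -yb exprMn (rmorphXn f i b).
by ring.
Qed.

End Goldman.

Lemma transcendental_adjoin (K : fieldType) (xs : seq K) (A : idomainType)
    (f : {rmorphism A -> K}) (x : K) : generates f xs -> x \in xs ->
  ~ (exists2 p : {poly A}, p != 0 & root (map_poly f p) x) ->
  exists2 g : {rmorphism {poly A} -> K}, injective g & generates g (rem x xs).
Proof.
move=> gen xxs tr; exists (horner_eval x \o map_poly f).
  apply: raddf_inj => p /eqP gp; apply: contrapT => /eqP p0.
  by apply: tr; exists p.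
move=> E Ec ED EM Ex; apply: gen => // [c|y yxs].
  by have := Ec c%:P; rewrite /= map_polyC /horner_eval hornerC.
move: yxs; rewrite (perm_mem (perm_to_rem xxs)) inE => /predU1P[->|/Ex//].
by have := Ec 'X; rewrite /= map_polyX /horner_eval hornerX.
Qed.

(** Induction on the number of generators: a transcendental generator can be moved into
    the base ring, where it yields a polynomial ring, contradicting
    [poly_not_goldman]; so all generators are algebraic. *)
Lemma goldman_of_generates (K : fieldType) (xs : seq K) (A : idomainType)
    (f : {rmorphism A -> K}) : injective f -> generates f xs -> goldman A.
Proof.
have [n le] := ubnP (size xs); elim: n => // n IH in xs le A f * => f_inj gen.
apply: (goldman_algebraic f_inj gen) => x xxs; apply: contrapT => tr.
have [g g_inj ggen] := transcendental_adjoin gen xxs tr.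
apply: (@poly_not_goldman A); apply: (IH (rem x xs)) ggen => //.
by rewrite size_rem // prednK //; move: xxs; case: (xs).
Qed.

Lemma generates_algebraic (K : fieldType) (xs : seq K) (A : idomainType)
    (f : {rmorphism A -> K}) (x : K) : generates f xs -> x \in xs ->
  exists2 p : {poly A}, p != 0 & root (map_poly f p) x.
Proof.
move=> gen xxs; apply: contrapT => tr.
have [g g_inj ggen] := transcendental_adjoin gen xxs tr.
exact/(@poly_not_goldman A)/(goldman_of_generates g_inj ggen).
Qed.

(** The generators are algebraic over k, hence in k, and they generate K. *)
Lemma zariski_closed (k : closedFieldType) (K : fieldType) (f : {rmorphism k -> K})
    (xs : seq K) : generates f xs -> forall x, exists c, x = f c.
Proof.
move=> gen.
have alg x : x \in xs -> exists c, x = f c.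
  move=> xxs.
  have [p p0 px] := generates_algebraic gen xxs.
  have [rs ep] := closed_field_poly_normal p.
  move: px; rewrite ep map_polyZ rootZ ?fmorph_eq0 ?lead_coef_eq0 //.
  rewrite rmorph_prod => /rootP; rewrite horner_prod => /eqP.
  rewrite prodf_seq_eq0 => /hasP[c _ /=].
  by rewrite map_polyXsubC hornerXsubC subr_eq0 => /eqP; exists c.
move=> x; suff : [set x | exists c, x = f c] = setT by move=> /seteqP[_]; apply.
apply: gen => // [c|_ _ [c ->] [d ->]|_ _ [c ->] [d ->]]; first by exists c.
- by exists (c + d); rewrite rmorphD.
- by exists (c * d); rewrite rmorphM.
Qed.

(** * Maximal ideals and the Nullstellensatz *)

Section ResidueField.
Variables (A : comNzRingType) (m : set A) (hm : maximal_ideal m).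

(** The proof of maximality is an argument of the predicate so that the ideal structure
    below can be attached to it. *)
Definition max_mem (_ : maximal_ideal m) : {pred A} := fun x => `[< m x >].

Lemma max_mem_idealr : idealr_closed (max_mem hm).
Proof.
have [[m0 mD mM] m1 _] := hm; split=> [||a x y].
- exact/asboolP.
- by apply/negP => /asboolP.
- by move=> /asboolP mx /asboolP my; apply/asboolP/mD => //; exact: mM.
Qed.

HB.instance Definition _ := isIdealr.Build A (max_mem hm) max_mem_idealr.

Definition residue_field := {ideal_quot (max_mem hm)}.
HB.instance Definition _ := GRing.ComNzRing.on residue_field.

Lemma residue_eq0 (x : A) : \pi_residue_field x = 0 -> m x.
Proof.
move=> e; suff : x \in max_mem hm by move=> /asboolP.
have /eqP : \pi_residue_field x = \pi_residue_field 0 by rewrite e piE.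
by rewrite -Quotient.idealrBE subr0.
Qed.

(** By maximality, a representative a of x and m generate the unit ideal, so that
    1 = b a + u with u in m.  The value 0 at 0 is the convention for inverses in
    fields. *)
Lemma residue_inv (x : residue_field) : exists y, (x != 0 -> y * x = 1) /\ (x = 0 -> y = 0).
Proof.
have [->|x0] := eqVneq x 0; first by exists 0; split.
have [mi m1 mmax] := hm; have [m0 mD mM] := mi.
pose a := repr x; have ea : \pi_residue_field a = x by exact: reprK.
have nma : ~ m a.
  move=> ma; case/eqP: x0; rewrite -ea.
  suff : \pi_residue_field a == \pi_residue_field 0 by move=> /eqP ->; rewrite piE.
  by rewrite -Quotient.idealrBE subr0; apply/asboolP.
pose J := [set z | exists b u, m u /\ z = b * a + u].
have [| |[b [u [mu e]]]|e] := mmax J.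
- split=> [|_ _ [b [u [mu ->]]] [c [v [mv ->]]]|c _ [b [u [mu ->]]]].
  + by exists 0, 0; split=> //; ring.
  + by exists (b + c), (u + v); split; [exact: mD|ring].
  + by exists (c * b), (c * u); split; [exact: mM|ring].
- by move=> u mu; exists 0, u; split=> //; ring.
- exists (\pi_residue_field b); split=> [_|/eqP]; last by rewrite (negPf x0).
  rewrite -ea.
  have -> : (1 : residue_field) = \pi_residue_field 1 by rewrite piE.
  rewrite -rmorphM; apply/eqP; rewrite -Quotient.idealrBE e opprD addrA subrr sub0r.
  by rewrite rpredN; apply/asboolP.
- by case: nma; rewrite -e; exists 1, 0; split=> //; ring.
Qed.

Definition residue_invr (x : residue_field) : residue_field :=
  projT1 (cid (residue_inv x)).

Lemma residue_mulVf (x : residue_field) : x != 0 -> residue_invr x * x = 1.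
Proof. by rewrite /residue_invr; case: cid => y [/= yx _ /yx]. Qed.

Lemma residue_invr0 : residue_invr 0 = 0.
Proof. by rewrite /residue_invr; case: cid => y [/= _ ->]. Qed.

HB.instance Definition _ :=
  GRing.ComNzRing_isField.Build residue_field residue_mulVf residue_invr0.

End ResidueField.

(** The residue field of m is generated by the images of the generators of S, so it is k
    by [zariski_closed]. *)
Lemma nullstellensatz_nz (k : closedFieldType) (S : comNzRingType)
    (eta : {rmorphism k -> S}) (m : set S) :
  finitely_generated eta -> maximal_ideal m -> forall s, exists c, m (s - eta c).
Proof.
move=> [xs gen] hm s.
pose pi : {rmorphism S -> residue_field hm} := \pi_(residue_field hm).
have [|c e] := @zariski_closed k _ (pi \o eta) (map pi xs) _ (pi s).
  move=> E Ec ED EM Ex; apply/seteqP; split=> // y _; rewrite -[y]reprK.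
  have : [set s | E (pi s)] = setT.
    apply: gen => // [x z|x z|x xxs] /=.
    - by rewrite rmorphD; exact: ED.
    - by rewrite rmorphM; exact: EM.
    - by apply: Ex; exact: map_f.
  by move=> /seteqP[_ /(_ (repr y))]; exact.
by exists c; apply: (residue_eq0 (hm := hm)); rewrite -/(pi _) rmorphB e subrr.
Qed.

(** A ring with a maximal ideal is not zero. *)
Lemma nullstellensatz (k : closedFieldType) (S : comPzRingType)
    (eta : {rmorphism k -> S}) (m : set S) :
  finitely_generated eta -> maximal_ideal m -> forall s, exists c, m (s - eta c).
Proof.
move=> fg hm.
have S10 : (1 : S) != 0.
  by apply/eqP => e; have [[m0 _ _] m1 _] := hm; apply: m1; rewrite e.
pose S' : comNzRingType := HB.pack S (GRing.PzSemiRing_isNonZero.Build S S10).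
exact: (@nullstellensatz_nz k S' eta m).
Qed.

(** Modulo m, an element outside m is a nonzero constant of k, hence a unit.  With
    [nullstellensatz], this characterizes the maximal ideals. *)
Lemma rational_maximal (k : fieldType) (S : comPzRingType) (eta : {rmorphism k -> S})
    (m : set S) :
  ideal m -> ~ m 1 -> (forall s, exists c, m (s - eta c)) -> maximal_ideal m.
Proof.
move=> mi m1 rat; have [m0 mD mM] := mi; split=> // J Ji mJ; have [J0 JD JM] := Ji.
have [Jm|/existsNP[x /not_implyP[Jx nmx]]] := pselect (J `<=` m).
  by right; apply/seteqP.
left; have [c mc] := rat x.
have Jc : J (eta c).
  have -> : eta c = x + (- 1) * (x - eta c) by ring.
  by apply: JD => //; apply: JM; exact: mJ.
have c0 : c != 0.
  by apply/eqP => c0; move: mc; rewrite c0 rmorph0 subr0.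
by rewrite -(rmorph1 eta) -(mulVf c0) rmorphM; exact: JM.
Qed.

(** Zorn's lemma on the proper ideals.  The empty set is admitted next to them, as the
    union of the empty chain. *)
Lemma maximal_ideal_exists (A : comPzRingType) : (1 : A) <> 0 ->
  exists q : spec A, Max q.
Proof.
move=> A10.
pose P (X : set A) := X = set0 \/ (ideal X /\ ~ X 1).
have [F FP Ftot|M [PM Mmax]] := @Zorn_bigcup A P.
  have [[X [FX X0]]|F0] := pselect (exists X, F X /\ X <> set0); last first.
    left; apply/seteqP; split=> // x [X FX Xx]; apply: F0; exists X; split=> //.
    by move=> X0; rewrite X0 in Xx.
  have idF Y x : F Y -> Y x -> ideal Y.
    by move=> FY Yx; have [Y0|[]//] := FP _ FY; rewrite Y0 in Yx.
  right; split.
    split=> [|x y [Y FY Yx] [Z FZ Zy]|a x [Y FY Yx]].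
    - by exists X => //; have [//|[[]]] := FP _ FX.
    - have [[_ YD _] [_ ZD _]] := (idF _ _ FY Yx, idF _ _ FZ Zy).
      have [YZ|ZY] := Ftot _ _ FY FZ.
        by exists Z => //; apply: ZD => //; exact: YZ.
      by exists Y => //; apply: YD => //; exact: ZY.
    - by exists Y => //; have [_ _ YM] := idF _ _ FY Yx; exact: YM.
  by move=> [Y FY Y1]; have [Y0|[]//] := FP _ FY; rewrite Y0 in Y1.
have ideal0 : ideal [set (0 : A)].
  by split=> [//|x y -> ->|a x ->]; rewrite /= ?addr0 ?mulr0.
case: PM => [M0|[iM M1]].
  case: (Mmax [set 0]); last by right; split=> //; exact/nesym.
  by rewrite M0; split=> // /(_ 0); exact.
have Mm : maximal_ideal M.
  split=> // J iJ MJ; apply: contrapT => /not_orP[J1 nJM].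
  by apply: (Mmax J); [split=> // JM; apply: nJM; apply/seteqP|right].
have [M0 MD MM] := iM.
have pM : prime_ideal M.
  split=> // x y Mxy; have [Mx|nMx] := pselect (M x); [by left|right].
  have [_ _ max] := Mm.
  pose J := [set z | M (z * y)].
  have [| |/=|e] := max J.
  - rewrite /J; split=> [|u v|a u] /=; first by rewrite mul0r.
      by rewrite mulrDl; exact: MD.
    by rewrite -mulrA; exact: MM.
  - by move=> z Mz; rewrite /J /= mulrC; exact: MM.
  - by rewrite /J /= mul1r; apply.
  - by case: nMx; rewrite -e.
by exists (Spec pM).
Qed.

(** * Prime ideals and domains *)

Lemma spec_ext (A : comPzRingType) (p q : spec A) : (forall x, p x <-> q x) -> p = q.
Proof.
case: p q => [p pP] [q qP] /= e.
have epq : p = q by apply: funext => x; apply: propext.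
by case: _ / epq qP => qP; congr Spec; exact: Prop_irrelevance.
Qed.

Lemma spec_unit (A : comPzRingType) (q : spec A) (a v : A) : a * v = 1 -> ~ q a.
Proof.
have [[_ _ qM] q1 _] := specP q => e qa; apply: q1.
by rewrite -e mulrC; exact: qM.
Qed.

Lemma specX (A : comPzRingType) (q : spec A) (a : A) N : ~ q a -> ~ q (a ^+ N).
Proof.
have [_ q1 qP] := specP q => qa; elim: N => [|N IH]; first by rewrite expr0.
by rewrite exprS => /qP[].
Qed.

Lemma specMl (A : comPzRingType) (q : spec A) (x y : A) : q x -> q (y * x).
Proof. by have [[_ _ qM] _ _] := specP q; exact: qM. Qed.

Lemma specMr (A : comPzRingType) (q : spec A) (x y : A) : q x -> q (x * y).
Proof. by rewrite mulrC; exact: specMl. Qed.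

Lemma spec_prime (A : comPzRingType) (q : spec A) (x y : A) : ~ q x -> q (x * y) -> q y.
Proof. by have [_ _ qP] := specP q => nx /qP[]. Qed.

Lemma spec0 (A : comPzRingType) (q : spec A) : q 0.
Proof. by have [[]] := specP q. Qed.

Lemma domain_mulI (A : comPzRingType) (a x y : A) : integral_domain A -> a <> 0 ->
  a * x = a * y -> x = y.
Proof.
move=> [_ dom] a0 e; have [|//|/eqP] := dom a (x - y).
  by rewrite mulrBr e subrr.
by rewrite subr_eq0 => /eqP.
Qed.

Lemma domainX (A : comPzRingType) (a : A) N : integral_domain A -> a <> 0 -> a ^+ N <> 0.
Proof.
move=> [A1 dom] a0; elim: N => [|N IH]; first by rewrite expr0.
by rewrite exprS => /dom[].
Qed.

Lemma inj_surj_bijective (X Y : Type) (f : X -> Y) :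
  injective f -> (forall y, exists x, f x = y) -> bijective f.
Proof.
move=> fi /choice[g fg]; exists g => [x|//].
by apply: fi; rewrite fg.
Qed.

Lemma bijective_noetherian (A B : comPzRingType) (f : {rmorphism A -> B}) :
  bijective f -> noetherian B -> noetherian A.
Proof.
move=> [g fK gK] nB I [I0 ID IM].
have image J : ideal J -> ideal (g @^-1` J).
  move=> [J0 JD JM]; split=> [|x y|a x] /=.
  - by have -> : g 0 = 0 by apply: (can_inj fK); rewrite gK rmorph0.
  - have -> : g (x + y) = g x + g y by apply: (can_inj fK); rewrite rmorphD !gK.
    exact: JD.
  - have -> : g (a * x) = g a * g x by apply: (can_inj fK); rewrite rmorphM !gK.
    exact: JM.
have [|s [sI sgen]] := nB (g @^-1` I); first exact: image.
exists (map g s); split=> [_ /mapP[y /sI ys ->]//|J iJ sJ x Ix].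
have := sgen _ (image _ iJ); rewrite -[x]fK; apply; last by rewrite /= fK.
by move=> y ys /=; apply: sJ; exact: map_f.
Qed.

Lemma bijective_noetherianE (A B : comPzRingType) (f : {rmorphism A -> B}) :
  bijective f -> noetherian A <-> noetherian B.
Proof.
move=> fb; split; last exact: bijective_noetherian fb.
have [g fK gK] := fb.
have gz : zmod_morphism g.
  by move=> x y; apply: (can_inj fK); rewrite rmorphB !gK.
have gm : monoid_morphism g.
  split=> [|x y]; apply: (can_inj fK); first by rewrite rmorph1 gK.
  by rewrite rmorphM !gK.
pose gMix := GRing.isZmodMorphism.Build B A g gz.
pose gMix' := GRing.isMonoidMorphism.Build B A g gm.
pose g' : {rmorphism B -> A} := HB.pack g gMix gMix'.
by apply: (@bijective_noetherian _ _ g'); exists f.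
Qed.

(** * Localization at the powers of an element *)

(** The rings of sections over D(a) are inverse limits, isomorphic to the rings of
    fractions only through the projections.  This characterization of A[1/a] up to
    isomorphism lets both be treated alike. *)
Record is_localization (A B : comPzRingType) (f : {rmorphism A -> B}) (a : A) : Prop :=
  IsLocalization {
    loc_inverts : exists v, f a * v = 1;
    loc_denom : forall y, exists N x, y * f a ^+ N = f x;
    loc_kernel : forall x, f x = 0 -> exists N, a ^+ N * x = 0 }.

Lemma is_localization_iso (A B C : comPzRingType) (f : {rmorphism A -> B})
    (g : {rmorphism A -> C}) (e : {rmorphism B -> C}) (a : A) :
  bijective e -> (forall x, e (f x) = g x) -> is_localization g a ->
  is_localization f a.
Proof.
move=> [h eK hK] ef [[v gv] gden gker]; split.
- by exists (h v); apply: (can_inj eK); rewrite rmorphM ef hK gv rmorph1.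
- move=> y; have [N [x ex]] := gden (e y); exists N, x.
  by apply: (can_inj eK); rewrite rmorphM rmorphXn !ef.
- by move=> x fx; apply: gker; rewrite -ef fx rmorph0.
Qed.

Lemma loc_powers (A : comPzRingType) (a : A) : is_localization (loc_in (powers a)) a.
Proof.
split.
- by apply: loc_in_unit; exists 1; rewrite expr1.
- elim/locW=> z; have [N eN] := denP z; exists N, (num z).
  by rewrite -rmorphXn -eN mklocE.
- move=> x /mklocP[_ [N ->]] /=; rewrite !mulr1 mulr0.
  by exists N.
Qed.

Section Localization.
Variables (A B : comPzRingType) (f : {rmorphism A -> B}) (a : A).
Hypothesis fl : is_localization f a.

Lemma localization_cancel N (x y : B) : x * f a ^+ N = y * f a ^+ N -> x = y.
Proof.
have [v e] := loc_inverts fl => /(congr1 (fun z => z * v ^+ N)).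
by rewrite -!mulrA -!exprMn e expr1n !mulr1.
Qed.

Lemma localization_inj : integral_domain A -> a <> 0 -> injective f.
Proof.
move=> dom a0; apply: raddf_inj => x /(loc_kernel fl)[N /(dom.2)[]//].
by move=> /(domainX dom a0).
Qed.

Lemma localization_domain : integral_domain A -> a <> 0 -> integral_domain B.
Proof.
move=> dom a0; have f_inj := localization_inj dom a0; split.
  rewrite -(rmorph1 f) -(rmorph0 f) => /f_inj; exact: dom.1.
have fden0 y N x : y * f a ^+ N = f x -> x = 0 -> y = 0.
  by move=> e x0; apply: (@localization_cancel N); rewrite e x0 rmorph0 mul0r.
move=> y z yz; have [N [x ey]] := loc_denom fl y; have [M [w ez]] := loc_denom fl z.
have : x * w = 0.
  apply: f_inj; rewrite rmorphM rmorph0 -ey -ez.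
  by rewrite mulrACA yz mul0r.
by move=> /dom.2[/(fden0 _ _ _ ey)|/(fden0 _ _ _ ez)]; [left|right].
Qed.

Lemma localization_finitely_generated (k : pzRingType) (eta : {rmorphism k -> A}) :
  finitely_generated eta -> finitely_generated (f \o eta : {rmorphism k -> B}).
Proof.
move=> [s gen]; have [v fv] := loc_inverts fl; exists (v :: map f s).
move=> E Ec ED EM Es; apply/seteqP; split=> // y _.
have E_f x : E (f x).
  have : [set x | E (f x)] = setT.
    apply: gen => [c|x' y'|x' y'|x' xs] /=.
    - exact: Ec.
    - by rewrite rmorphD; exact: ED.
    - by rewrite rmorphM; exact: EM.
    - by apply: Es; rewrite inE map_f ?orbT.
  by move=> /seteqP[_]; apply.
have [N [x e]] := loc_denom fl y.
have -> : y = f x * v ^+ N.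
  by rewrite -e -mulrA -exprMn fv expr1n mulr1.
apply: (EM) => //; elim: N {e} => [|N IH]; first by rewrite expr0 -(rmorph1 f).
by rewrite exprS; apply: EM => //; apply: Es; exact: mem_head.
Qed.

(** The ideal generated by f(q) consists of the fractions with numerator in q; it is
    prime and contracts to q because q contains no power of a. *)
Lemma localization_spec (q : spec A) : ~ q a -> exists q' : spec B, spec_map f q' = q.
Proof.
move=> qa; have [[q0 qD qM] q1 qP] := specP q.
pose I := [set y | exists N x, q x /\ y * f a ^+ N = f x].
have If x : I (f x) -> q x.
  move=> [N [z [qz]]]; rewrite -rmorphXn -rmorphM => /eqP.
  rewrite -subr_eq0 -rmorphB => /eqP/(loc_kernel fl)[M e].
  have : q (x * a ^+ N * a ^+ M).
    have -> : x * a ^+ N * a ^+ M = a ^+ M * (x * a ^+ N - z) + a ^+ M * z by ring.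
    by rewrite e add0r; exact: qM.
  by rewrite -mulrA -exprD mulrC => /(spec_prime (specX qa)).
have pI : prime_ideal I.
  split.
  - split=> [|y z [N [x [qx ex]]] [M [w [qw ew]]]|b y [N [x [qx ex]]]].
    + by exists 0%N, 0; rewrite mul0r rmorph0.
    + exists (N + M)%N, (x * a ^+ M + w * a ^+ N); split.
        by apply: qD; rewrite mulrC; exact: qM.
      by rewrite rmorphD !rmorphM !rmorphXn -ex -ew exprD; ring.
    + have [M [w ew]] := loc_denom fl b; exists (N + M)%N, (w * x).
      by split; [exact: qM|rewrite rmorphM -ex -ew exprD; ring].
  - by rewrite -(rmorph1 f) => /If.
  - move=> y z [N [x [qx e]]].
    have [M [u eu]] := loc_denom fl y; have [L [w ew]] := loc_denom fl z.
    have : q (u * w).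
      apply: If; exists N, (x * a ^+ (M + L)); split; first by rewrite mulrC; exact: qM.
      by rewrite !rmorphM rmorphXn -e -eu -ew exprD; ring.
    by move=> /qP[qu|qw]; [left; exists M, u|right; exists L, w].
exists (Spec pI); apply: spec_ext => x; split; first exact: If.
by move=> qx; exists 0%N, x; rewrite expr0 mulr1.
Qed.

(** As a is already a unit in the local ring of A, fractions of elements x/a^N and w/a^M of
    A[1/a] are fractions x a^M / w a^N of elements of A; so both local rings agree. *)
Lemma localization_loc_at (q : spec B) : bijective (loc_at_map f q).
Proof.
have [v fv] := loc_inverts fl; have qa : ~ q (f a) := spec_unit fv.
apply: inj_surj_bijective.
  apply: raddf_inj; elim/locW=> z e.
  have := loc_lift_mk (@loc_at_map_unit _ _ f q) z.
  rewrite -/(loc_at_map f q) e mul0r => /esym/mklocP[u qu] /=.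
  rewrite !mulr1 mulr0; have [N [w ew]] := loc_denom fl u.
  move=> uz; have : f (w * num z) = 0 by rewrite rmorphM -ew mulrAC uz mul0r.
  move=> /(loc_kernel fl)[M aM]; apply/mklocP; exists (a ^+ M * w) => /=.
    rewrite rmorphM -ew rmorphXn => /(spec_prime (specX qa)).
    by rewrite mulrC => /(spec_prime (specX qa)).
  by rewrite mul0r mulr0 mulr1 -mulrA.
elim/locW=> z; have [N [x ex]] := loc_denom fl (num z).
have [M [w ew]] := loc_denom fl (den z).
have qw : prime_compl (spec_map f q) (w * a ^+ N).
  rewrite /= rmorphM -ew rmorphXn -mulrA -exprD mulrC => /(spec_prime (specX qa)).
  exact: (denP z).
exists (mkloc (@Frac _ (prime_compl (spec_map f q)) (x * a ^+ M) _ qw)).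
apply: loc_lift_eq => /=; rewrite !rmorphM -ex -ew !rmorphXn.
by rewrite !rmorphM /= -(mklocE z) !rmorphXn; ring.
Qed.

End Localization.

(** * Equality of local rings *)

Section LocAtMap.
Variables (R S : comPzRingType) (phi : {rmorphism R -> S}) (q : spec S).
Hypotheses (S_domain : integral_domain S) (phi_inj : injective phi).

Lemma loc_at_in_inj : injective (loc_in (prime_compl q)).
Proof.
move=> x y /mklocP[u qu] /=; rewrite !mulr1; apply: domain_mulI => //.
by move=> u0; apply: qu; rewrite u0; exact: spec0.
Qed.

(** Equality of the local rings, inside the fraction field of S: every s/t with t outside
    q is some phi(r)/phi(w) with phi(w) outside q.  In this form it involves elements of
    R and S only, and can be moved along a change of rings. *)
Lemma loc_at_map_bijective : bijective (loc_at_map phi q) <->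
  forall s t, ~ q t -> exists r w, ~ q (phi w) /\ s * phi w = phi r * t.
Proof.
split=> [[g _ gK] s t qt|h].
  pose y : loc_at q := mkloc (@Frac _ (prime_compl q) s t qt).
  have := gK y; elim/locW: (g y) => z e.
  exists (num z), (den z); split; first exact: (denP z).
  apply: loc_at_in_inj.
  have /esym := loc_lift_mk (@loc_at_map_unit _ _ phi q) z.
  rewrite -/(loc_at_map phi q) e /= => e'.
  rewrite [RHS]rmorphM /= e' mulrAC /y.
  have -> : loc_in (prime_compl q) t = loc_in _ (den (@Frac _ (prime_compl q) s t qt)) by [].
  by rewrite mklocE -rmorphM.
apply: inj_surj_bijective.
  apply: raddf_inj; elim/locW=> z e.
  have := loc_lift_mk (@loc_at_map_unit _ _ phi q) z.
  rewrite -/(loc_at_map phi q) e mul0r /= -(rmorph0 (loc_in (prime_compl q))).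
  move=> /loc_at_in_inj; rewrite -(rmorph0 phi) => /phi_inj nz.
  by apply/mklocP; exists 1; [exact: mset1|rewrite -nz /= !mul0r].
elim/locW=> z; have [r [w [qw e]]] := h (num z) (den z) (denP z).
exists (mkloc (@Frac _ (prime_compl (spec_map phi q)) r w qw)).
apply: loc_lift_eq => /=; rewrite -[LHS]/(loc_mul _ _) mkloc_mul.
by apply/mklocP; exists 1; [exact: mset1|rewrite /= !mulr1 e].
Qed.

End LocAtMap.

(** * Maximal ideals of finitely generated algebras *)

(** The residue ring of the contraction lies between k and T/m = k. *)
Lemma contract_maximal (k : closedFieldType) (S T : comPzRingType)
    (eta : {rmorphism k -> S}) (g : {rmorphism S -> T}) (m : spec T) :
  finitely_generated (g \o eta : {rmorphism k -> T}) -> Max m -> Max (spec_map g m).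
Proof.
move=> fg mm; have [gi g1 _] := specP (spec_map g m).
apply: (rational_maximal (eta := eta)) => // s.
have [c mc] := nullstellensatz fg mm (g s).
by exists c; rewrite /= rmorphB.
Qed.

(** Rabinowitsch's trick: contract a maximal ideal of S[1/t]. *)
Lemma maximal_avoiding (k : closedFieldType) (S : comPzRingType)
    (eta : {rmorphism k -> S}) (t : S) :
  finitely_generated eta -> integral_domain S -> t <> 0 ->
  exists n : spec S, Max n /\ ~ n t.
Proof.
move=> fg dom t0; have tl := loc_powers t.
have [m mm] := maximal_ideal_exists (localization_domain tl dom t0).1.
exists (spec_map (loc_in (powers t)) m); split.
  by apply: contract_maximal mm; exact: (localization_finitely_generated tl fg).
by have [v tv] := loc_inverts tl; exact: spec_unit tv.
Qed.

(** The elements of S that become elements of R after multiplication by a power of t form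
    a subalgebra; t is chosen as the product of denominators of the generators. *)
Lemma common_denominator (k : pzRingType) (R S : comPzRingType)
    (eta : {rmorphism k -> R}) (phi : {rmorphism R -> S}) (q : spec S) :
  finitely_generated (phi \o eta : {rmorphism k -> S}) ->
  (forall s, exists r w, ~ q (phi w) /\ s * phi w = phi r) ->
  exists t, ~ q (phi t) /\ forall s, exists N r, s * phi t ^+ N = phi r.
Proof.
move=> [xs gen] loc.
have [t [qt tP]] : exists t, ~ q (phi t) /\ forall x, x \in xs -> exists r, x * phi t = phi r.
  elim: xs {gen} => [|x xs [t [qt tP]]].
    by exists 1; rewrite rmorph1; split=> //; have [] := specP q.
  have [r [w [qw e]]] := loc x; exists (t * w); split.
    by rewrite rmorphM => /(spec_prime qt).
  move=> y; rewrite inE => /predU1P[->|/tP[r' e']].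
    by exists (t * r); rewrite !rmorphM -e; ring.
  by exists (r' * w); rewrite !rmorphM -e'; ring.
exists t; split=> // s.
suff : [set s | exists N r, s * phi t ^+ N = phi r] = setT by move=> /seteqP[_]; apply.
apply: gen => [c|x y [N [r e]] [M [u e']]|x y [N [r e]] [M [u e']]|x /tP[r e]].
- by exists 0%N, (eta c); rewrite mulr1.
- exists (N + M)%N, (r * t ^+ M + u * t ^+ N).
  by rewrite rmorphD !rmorphM !rmorphXn -e -e' exprD; ring.
- by exists (N + M)%N, (r * u); rewrite rmorphM -e -e' exprD; ring.
- by exists 1%N, r.
Qed.

(** * Depictions and localization *)

(** A commutative square of phi : R -> S and phi' : R[1/a] -> S[1/a], for abstract
    localizations alpha : R -> R[1/a] and sigma : S -> S[1/a]. *)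
Section Transfer.
Variables (R S R' S' : comPzRingType) (phi : {rmorphism R -> S}).
Variables (phi' : {rmorphism R' -> S'}).
Variables (alpha : {rmorphism R -> R'}) (sigma : {rmorphism S -> S'}) (a : R).
Hypothesis alpha_loc : is_localization alpha a.
Hypothesis sigma_loc : is_localization sigma (phi a).
Hypothesis square : forall r, phi' (alpha r) = sigma (phi r).
Hypothesis S_domain : integral_domain S.
Hypothesis phi_inj : injective phi.
Hypothesis a_neq0 : a <> 0.

Let phia0 : phi a <> 0.
Proof. by rewrite -(rmorph0 phi) => /phi_inj. Qed.
Let S'_domain := localization_domain sigma_loc S_domain phia0.
Let sigma_inj := localization_inj sigma_loc S_domain phia0.

Lemma localized_inj : injective phi'.
Proof.
apply: raddf_inj => x; have [N [r e]] := loc_denom alpha_loc x.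
move=> /(congr1 (fun z => z * phi' (alpha a) ^+ N)).
rewrite -rmorphXn -rmorphM e mul0r square -(rmorph0 sigma).
move=> /sigma_inj; rewrite -(rmorph0 phi) => /phi_inj r0.
by apply: (localization_cancel alpha_loc (N := N)); rewrite e r0 rmorph0 mul0r.
Qed.

Lemma localized_contraction (n : spec S') :
  spec_map alpha (spec_map phi' n) = spec_map phi (spec_map sigma n).
Proof. by apply: spec_ext => x /=; rewrite square. Qed.

(** A prime p of R[1/a] contracts to a prime of R not containing a; a prime of S over it
    does not contain phi(a), and so extends to S[1/a]. *)
Lemma localized_spec : (forall p : spec R, exists q, spec_map phi q = p) ->
  forall p : spec R', exists q, spec_map phi' q = p.
Proof.
move=> surj p; have [v av] := loc_inverts alpha_loc.
have pa := spec_unit (q := p) av.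
have [q eq] := surj (spec_map alpha p).
have [|q' eq'] := localization_spec sigma_loc (q := q).
  by move=> qa; apply: pa; have : spec_map phi q a := qa; rewrite eq.
exists q'; apply: spec_ext => x.
have [N [r e]] := loc_denom alpha_loc x.
have -> : spec_map phi' q' x <-> spec_map alpha p r.
  rewrite -eq -eq' -localized_contraction /= -e rmorphM; split; first exact: specMr.
  rewrite mulrC; apply: spec_prime; rewrite rmorphXn; apply: specX.
  rewrite square => q'a; apply: pa; have : spec_map phi q a by rewrite -eq'.
  by rewrite eq.
rewrite /= -e; split; last exact: specMr.
by rewrite mulrC; apply: spec_prime; exact: specX.
Qed.

(** A fraction s/t of S[1/a] can be written with s and t in S, and likewise for R, as a
    is a unit at n; hence the criterion of [loc_at_map_bijective] reads the same for
    n and for its contraction to S. *)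
Lemma localized_loc_at (n : spec S') :
  bijective (loc_at_map phi' n) <-> bijective (loc_at_map phi (spec_map sigma n)).
Proof.
have [v av] := loc_inverts sigma_loc; have na := spec_unit (q := n) av.
rewrite (loc_at_map_bijective n S'_domain localized_inj).
rewrite (loc_at_map_bijective _ S_domain phi_inj).
split=> h s t nt.
  have [r [w [nw e]]] := h (sigma s) (sigma t) nt.
  have [N [r' er]] := loc_denom alpha_loc r; have [M [w' ew]] := loc_denom alpha_loc w.
  exists (r' * a ^+ M), (w' * a ^+ N); split.
    rewrite /= -square rmorphM -ew !rmorphM !rmorphXn !square -mulrA -exprD mulrC.
    by move=> /(spec_prime (specX na)).
  apply: sigma_inj; rewrite !rmorphM -!square -er -ew !rmorphM !rmorphXn !square.
  transitivity (sigma s * phi' w * sigma (phi a) ^+ (N + M)); first by rewrite exprD; ring.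
  by rewrite e exprD; ring.
have [N [s' es]] := loc_denom sigma_loc s; have [M [t' et]] := loc_denom sigma_loc t.
have nt' : ~ spec_map sigma n t'.
  by rewrite /= -et mulrC => /(spec_prime (specX na)).
have [r [w [nw e]]] := h s' t' nt'.
exists (alpha (r * a ^+ M)), (alpha (w * a ^+ N)); split.
  by rewrite square rmorphM mulrC rmorphM !rmorphXn => /(spec_prime (specX na)).
apply: (localization_cancel sigma_loc (N := 0)); rewrite !mulr1 !square.
rewrite !rmorphM !rmorphXn /=.
have {}e := congr1 sigma e; rewrite !rmorphM -es -et in e.
transitivity (s * sigma (phi a) ^+ N * sigma (phi w)); first by ring.
by rewrite e; ring.
Qed.

(** The local ring of R[1/a] at the contraction of n is that of R, by
    [localization_loc_at]. *)
Lemma localized_noetherian (n : spec S') :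
  noetherian (loc_at (spec_map phi' n)) <->
  noetherian (loc_at (spec_map phi (spec_map sigma n))).
Proof.
have b := localization_loc_at alpha_loc (spec_map phi' n).
by rewrite -(bijective_noetherianE b) localized_contraction.
Qed.

Lemma localized_depiction (k : closedFieldType) (eta : {rmorphism k -> R}) :
  depiction phi eta ->
  depiction phi' (alpha \o eta : {rmorphism k -> R'}).
Proof.
move=> [_ fg _ surj [UE [n0 [n0max n0bij]]]].
have fg' : finitely_generated (sigma \o (phi \o eta) : {rmorphism k -> S'}).
  exact: (localization_finitely_generated sigma_loc fg).
split.
- exact: S'_domain.
- have [xs gen] := fg'; exists xs => E Ec; apply: gen => c.
  by have := Ec c; rewrite /= square.
- exact: localized_inj.
- exact: localized_spec.
split.
  apply/seteqP; split=> n [nmax nP]; split=> //.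
    have : U_locus phi (spec_map sigma n).
      by split; [exact: contract_maximal fg' nmax|exact/localized_loc_at].
    by rewrite UE => -[_ ?]; apply/localized_noetherian.
  have : noetherian_locus phi (spec_map sigma n).
    by split; [exact: contract_maximal fg' nmax|exact/localized_noetherian].
  by rewrite -UE => -[_ ?]; apply/localized_loc_at.
(* The locus of S over R contains the open set where t does not vanish. *)
have [|t [n0t tP]] := @common_denominator k R S eta phi n0 fg.
  move=> s; have [|r [w [qw e]]] := (loc_at_map_bijective n0 S_domain phi_inj).1 n0bij s 1.
    by have [] := specP n0.
  by exists r, w; rewrite e mulr1.
have t0 : sigma (phi t) <> 0.
  rewrite -(rmorph0 sigma) => /sigma_inj t0; apply: n0t; rewrite t0; exact: spec0.
have [n [nmax nt]] := maximal_avoiding fg' S'_domain t0.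
exists n; split=> //; apply/localized_loc_at/loc_at_map_bijective => // s u nu.
have [N [r er]] := tP s; have [M [w ew]] := tP u.
(* s = r / t^N and u = w / t^M, so that s / u = (r t^M) / (w t^N). *)
exists (r * t ^+ M), (w * t ^+ N); split.
  rewrite /= rmorphM -ew rmorphXn -mulrA -exprD rmorphM mulrC rmorphXn.
  by move=> /(spec_prime (specX nt)).
by rewrite !rmorphM -er -ew !rmorphXn; ring.
Qed.

End Transfer.

(** * The rings of sections over a principal open set *)

Section TensorLeft.
Variables (R S T : comPzRingType) (f : {rmorphism R -> S}) (g : {rmorphism R -> T}).

Lemma pureM s t s' t' : pure f g s t * pure f g s' t' = pure f g (s * s') (t * t').
Proof. by rewrite -[LHS]/(tens_mul _ _) mktens_mul. Qed.

Definition tens_inl (s : S) : tensor f g := pure f g s 1.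

Let tens_inl_zmod : zmod_morphism tens_inl.
Proof.
have [bl _ _] := pure_balanced f g => s s'.
by apply: (addIr (tens_inl s')); rewrite subrK -bl subrK.
Qed.

Let tens_inl_monoid : monoid_morphism tens_inl.
Proof. by split=> // s s'; rewrite [RHS]pureM mulr1. Qed.

HB.instance Definition _ := GRing.isZmodMorphism.Build S (tensor f g) tens_inl tens_inl_zmod.
HB.instance Definition _ :=
  GRing.isMonoidMorphism.Build S (tensor f g) tens_inl tens_inl_monoid.

Lemma tens_inlr (r : R) : tens_inl (f r) = tens_inr f g (g r).
Proof.
have [_ _ bm] := pure_balanced f g.
by have := bm r 1 1; rewrite !mulr1.
Qed.

End TensorLeft.

Section BaseChange.
Variables (R S : comPzRingType) (phi : {rmorphism R -> S}).

Definition base_change_in (a : R) : {rmorphism S -> base_change phi a} :=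
  tens_inl phi (loc_in (powers a)).

Lemma base_change_res_in (a b : R) (ba : principal_open b `<=` principal_open a) s :
  base_change_res phi ba (base_change_in a s) = base_change_in b s.
Proof. by rewrite [LHS]tens_map_pure rmorph1. Qed.

(** An element s (x) r/a^N is (s phi(r) (x) 1) / phi(a)^N.  If s (x) 1 = 0, then s = 0 in
    S[1/phi(a)], because s (x) r/a^N |-> s phi(r)/phi(a)^N is well defined. *)
Lemma base_change_localization (a : R) : is_localization (base_change_in a) (phi a).
Proof.
have al := loc_powers a; have pl := loc_powers (phi a).
have inv : forall w, powers a w -> exists v, (loc_in (powers (phi a)) \o phi) w * v = 1.
  move=> _ [N ->] /=; apply: loc_in_unit; exists N; exact: rmorphXn.
pose lift : {rmorphism loc (powers a) -> loc (powers (phi a))} := loc_lift inv.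
have liftE r : lift (loc_in _ r) = loc_in _ (phi r) by exact: loc_lift_in.
pose beta (s : S) (t : loc (powers a)) := loc_in (powers (phi a)) s * lift t.
have bal : balanced phi (loc_in (powers a)) beta.
  split=> [s s' t|s t t'|r s t]; rewrite /beta.
  - by rewrite rmorphD mulrDl.
  - by rewrite rmorphD mulrDr.
  - by rewrite !rmorphM liftE; ring.
split.
- have [v av] := loc_inverts al; exists (tens_inr _ _ v).
  by rewrite /base_change_in /= tens_inlr -rmorphM av rmorph1.
- elim/tensW; elim=> [|[s t] l [M [y ey]]].
    by exists 0%N, 0; rewrite rmorph0 [X in X * _](_ : _ = 0) ?mul0r.
  have [N [r er]] := loc_denom al t.
  exists (N + M)%N, (s * phi r * phi a ^+ M + y * phi a ^+ N).
  rewrite mktensE big_cons -mktensE /= mulrDl rmorphD; congr (_ + _).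
    rewrite [RHS]rmorphM rmorphXn exprD mulrA; congr (_ * _).
    have -> : base_change_in a (s * phi r) = pure phi (loc_in (powers a)) s (loc_in _ r).
      by rewrite rmorphM /= tens_inlr [LHS]pureM mulr1 mul1r.
    by rewrite -er -!rmorphXn /= tens_inlr [LHS]pureM mulr1 !rmorphXn.
  by rewrite exprD [RHS]rmorphM rmorphXn -ey; ring.
- move=> s e; apply: (loc_kernel pl).
  have := tens_lift_pure bal s 1; rewrite -/(tens_inl _ _ s).
  by rewrite [tens_inl _ _ s]e raddf0 /beta rmorph1 mulr1 => ->.
Qed.

Definition sheafification_section (U : opens (spec R)) (s : S) : sheafification phi U.
Proof.
exists (fun a _ => base_change_in a s) => a b aU bU ba.
exact: base_change_res_in.
Defined.

Let section_zmod U : zmod_morphism (sheafification_section U).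
Proof. by move=> x y; apply: limit_eq => a aU; exact: rmorphB. Qed.

Let section_monoid U : monoid_morphism (sheafification_section U).
Proof.
split=> [|x y]; apply: limit_eq => a aU; first exact: rmorph1.
exact: rmorphM.
Qed.

HB.instance Definition _ U := GRing.isZmodMorphism.Build
  S (sheafification phi U) (sheafification_section U) (section_zmod U).
HB.instance Definition _ U := GRing.isMonoidMorphism.Build
  S (sheafification phi U) (sheafification_section U) (section_monoid U).

End BaseChange.

Section LimitProj.
Variables (R : comPzRingType) (F : R -> comPzRingType).
Variable rho : forall a b : R,
  principal_open b `<=` principal_open a -> {rmorphism F a -> F b}.
Variables (U : set (spec R)) (a : R) (aU : principal_open a `<=` U).

(** The projection is named so that it can carry the structure of a ring morphism. *)
Definition limit_proj (x : limit rho U) : F a := x a aU.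

Let limit_proj_zmod : zmod_morphism limit_proj. Proof. by []. Qed.
Let limit_proj_monoid : monoid_morphism limit_proj. Proof. by split. Qed.

HB.instance Definition _ := GRing.isZmodMorphism.Build
  (limit rho U) (F a) limit_proj limit_proj_zmod.
HB.instance Definition _ := GRing.isMonoidMorphism.Build
  (limit rho U) (F a) limit_proj limit_proj_monoid.

End LimitProj.

Lemma global_section_localization (R : comPzRingType) (a : R) :
  is_localization (@global_section R (principal a)) a.
Proof.
pose e := @limit_proj R _ (@inv_ring_res R) _ a (@subset_refl _ (principal_open a)).
apply: (@is_localization_iso _ _ _ _ _ e); last exact: loc_powers.
  exact: structure_sheaf_principal.
by [].
Qed.

Lemma sheafification_section_localization (R S : comPzRingType) (phi : {rmorphism R -> S})
    (a : R) : is_localization (sheafification_section phi (principal a)) (phi a).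
Proof.
pose e := @limit_proj R _ (@base_change_res _ _ phi) _ a (@subset_refl _ (principal_open a)).
apply: (@is_localization_iso _ _ _ _ _ e); last exact: base_change_localization.
  exact: sheafification_principal.
by [].
Qed.

Lemma sheafification_unit_section (R S : comPzRingType) (phi : {rmorphism R -> S})
    (U : opens (spec R)) (r : R) :
  sheafification_unit phi U (global_section U r) = sheafification_section phi U (phi r).
Proof. by apply: limit_eq => a aU; rewrite /= tens_inlr. Qed.

Lemma principal_open0 (R : comPzRingType) (a : R) : principal_open a !=set0 -> a <> 0.
Proof. by move=> [p pa] a0; apply: pa; rewrite a0; exact: spec0. Qed.

(** * The sheaf property *)

Lemma domain_principal_open (R : comPzRingType) (a : R) :
  integral_domain R -> a <> 0 -> principal_open a !=set0.
Proof.
move=> dom a0; have [| |p [_ pa]] := @prime_avoidance R (powers a) [set 0].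
- by split=> [//|x y -> ->|c x ->]; rewrite /= ?addr0 ?mulr0.
- by move=> _ [N ->]; exact: domainX.
- by exists p; apply: pa; exists 1%N; rewrite expr1.
Qed.

Lemma subdomain (R S : comPzRingType) (phi : {rmorphism R -> S}) :
  integral_domain S -> injective phi -> integral_domain R.
Proof.
move=> [S1 dom] phi_inj; split=> [e|x y e].
  by apply: S1; rewrite -(rmorph1 phi) e rmorph0.
have [||] := dom (phi x) (phi y); first by rewrite -rmorphM e rmorph0.
  by rewrite -(rmorph0 phi) => /phi_inj; left.
by rewrite -(rmorph0 phi) => /phi_inj; right.
Qed.

Section DomainSheaf.
Variables (R S : comPzRingType) (phi : {rmorphism R -> S}).
Hypotheses (S_domain : integral_domain S) (phi_inj : injective phi).
Local Notation D := principal_open.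

Let R_domain : integral_domain R := subdomain S_domain phi_inj.
Let phi_neq0 (a : R) : a <> 0 -> phi a <> 0.
Proof. by rewrite -(rmorph0 phi) => a0 /phi_inj. Qed.

(** The image of a in the ring of sections over D(a) is invertible; for a = 0 it is 0. *)
Lemma base_change_zero (a : R) (x y : base_change phi a) : a = 0 -> x = y.
Proof.
move=> a0; have pa0 : phi a = 0 by rewrite a0 rmorph0.
have [v] := loc_inverts (base_change_localization phi a).
rewrite pa0 rmorph0 mul0r => e.
by rewrite -[x]mul1r -[y]mul1r -e !mul0r.
Qed.

Lemma base_change_in_inj (a : R) : a <> 0 -> injective (base_change_in phi a).
Proof.
move=> a0; apply: (localization_inj (base_change_localization phi a)) => //.
exact: phi_neq0.
Qed.

Lemma base_change_res_inj (a b : R) (ba : D b `<=` D a) :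
  b <> 0 -> injective (base_change_res phi ba).
Proof.
move=> b0; have al := base_change_localization phi a.
apply: raddf_inj => x; have [N [s e]] := loc_denom al x.
move=> /(congr1 (fun z => z * base_change_res phi ba (base_change_in phi a (phi a)) ^+ N)).
rewrite -rmorphXn -rmorphM e mul0r base_change_res_in -(rmorph0 (base_change_in phi b)).
move=> /(base_change_in_inj b0) s0.
by apply: (localization_cancel al (N := N)); rewrite e s0 rmorph0 mul0r.
Qed.

Section Fraction.
Variables (m d : S).
Hypothesis d_neq0 : d <> 0.

(** The fraction m/d of S, as a section over D(a). *)
Definition represents (a : R) (x : base_change phi a) : Prop :=
  x * base_change_in phi a d = base_change_in phi a m.

Lemma represents_uniq (a : R) (x y : base_change phi a) :
  represents x -> represents y -> x = y.
Proof.
have [a0|a0] := pselect (a = 0); first by move=> *; exact: base_change_zero.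
have dom := localization_domain (base_change_localization phi a) S_domain (phi_neq0 a0).
rewrite /represents => <- /esym.
rewrite mulrC [y * _]mulrC; apply: domain_mulI => //.
by rewrite -(rmorph0 (base_change_in phi a)) => /(base_change_in_inj a0).
Qed.

Lemma represents_res (a b : R) (ba : D b `<=` D a) (x : base_change phi a) :
  represents x -> represents (base_change_res phi ba x).
Proof.
by rewrite /represents -!(base_change_res_in phi ba) -rmorphM => ->.
Qed.

Lemma represents_res_inv (a b : R) (ba : D b `<=` D a) (x : base_change phi a) :
  b <> 0 -> represents (base_change_res phi ba x) -> represents x.
Proof.
move=> b0; rewrite /represents -!(base_change_res_in phi ba) -rmorphM.
exact: base_change_res_inj.
Qed.

(** The ideal J of the r in R with r m/d in S lies in no prime of D(a): a prime p in D(a)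
    has a neighbourhood D(b) on which m/d is a section s/b^N, and then b^N is in J but
    not in p.  By prime avoidance J contains a power of a. *)
Lemma represents_local (a : R) :
  (forall p, D a p -> exists b, D b p /\ exists x : base_change phi b, represents x) ->
  exists x : base_change phi a, represents x.
Proof.
move=> local.
pose J := [set r : R | exists s, phi r * m = s * d].
have iJ : ideal J.
  split=> [|x y [s es] [t et]|c x [s es]].
  - by exists 0; rewrite rmorph0 !mul0r.
  - by exists (s + t); rewrite rmorphD !mulrDl es et.
  - by exists (phi c * s); rewrite rmorphM -!mulrA es.
have [N [s es]] : exists N, J (a ^+ N).
  apply: contrapT => nex.
  have [//| |p [Jp pW]] := @prime_avoidance R (powers a) J.
    by move=> _ [N ->] JN; apply: nex; exists N.
  have pa : ~ p a by apply: pW; exists 1%N; rewrite expr1.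
  have [b [pb [x rx]]] := local p pa.
  have [N [s es]] := loc_denom (base_change_localization phi b) x.
  apply: (specX (N := N) pb); apply: Jp; exists s.
  have b0 : b <> 0 by apply: principal_open0; exists p.
  apply: (base_change_in_inj b0); rewrite !rmorphM rmorphXn -es -rx.
  by rewrite rmorphXn; ring.
have [v av] := loc_inverts (base_change_localization phi a).
exists (base_change_in phi a s * v ^+ N); rewrite /represents mulrAC -rmorphM -es.
by rewrite rmorphM !rmorphXn mulrAC -exprMn av expr1n mul1r.
Qed.

End Fraction.

(** The common fraction m/d of the compatible local sections is read off on one nonempty
    D(b0); it is the right one on any other D(b) because D(b) meets D(b0), Spec R being
    irreducible. *)
Lemma sheafification_sheaf : sheaf (sheafification phi).
Proof.
move=> I U V UV cover s compat.
have lfam_irr (W : set (spec R)) (x : limit (@base_change_res _ _ phi) W) a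
    (p q : D a `<=` W) : x a p = x a q by congr (lfam x).
have sE i j b (bi : D b `<=` U i) (bj : D b `<=` U j) : s i b bi = s j b bj.
  have bij : D b `<=` opensI (U i) (U j) by move=> p pb; split; [exact: bi|exact: bj].
  have /(congr1 (fun x : limit (@base_change_res _ _ phi) _ => x b bij)) /= := compat i j.
  move=> e; rewrite (lfam_irr _ _ _ bi (subset_trans bij (@subIsetl _ _ _))) e.
  exact: lfam_irr.
have local p : open_set V p -> exists i b, D b p /\ D b `<=` U i.
  move=> /cover[i _ Up]; have [b [pb bU]] := (openP (U i) : zariski_open _) p Up.
  by exists i, b.
have [m [d [d0 sP]]] : exists m d, d <> 0 /\
    forall i b (bU : D b `<=` U i), represents m d (s i b bU).
  have [[i0 [b0 [b0U b00]]]|no] := pselect (exists i b, D b `<=` U i /\ b <> 0); last first.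
    (* All the open sets of the cover are empty, and any fraction will do. *)
    exists 0, 1; split=> [|i b bU]; first exact: S_domain.1.
    by apply: base_change_zero; apply: contrapT => b0; apply: no; exists i, b.
  have [N [m em]] := loc_denom (base_change_localization phi b0) (s i0 b0 b0U).
  have d0 : phi b0 ^+ N <> 0 by apply: domainX => //; exact: phi_neq0.
  exists m, (phi b0 ^+ N); split=> // i b bU.
  have [bz|bz] := pselect (b = 0); first exact: base_change_zero.
  have cb : D (b * b0) `<=` D b by rewrite principal_openM; exact: subIsetl.
  have cb0 : D (b * b0) `<=` D b0 by rewrite principal_openM; exact: subIsetr.
  have c0 : b * b0 <> 0 by move=> /R_domain.2[].
  apply: (represents_res_inv (ba := cb)) => //.
  rewrite (lfam_compat (s i) bU (subset_trans cb bU)).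
  rewrite (sE _ i0 _ _ (subset_trans cb0 b0U)) -(lfam_compat (s i0) b0U _ cb0).
  by apply: represents_res; rewrite /represents rmorphXn.
have ex a (aV : D a `<=` V) : exists x : base_change phi a, represents m d x.
  apply: represents_local => // p /aV/local[i [b [pb bU]]].
  by exists b; split=> //; exists (s i b bU).
pose t0 a (aV : D a `<=` V) := projT1 (cid (ex a aV)).
have t0P a aV : represents m d (@t0 a aV) by rewrite /t0; case: cid.
have t0C a b (aV : D a `<=` V) (bV : D b `<=` V) (ba : D b `<=` D a) :
    base_change_res phi ba (t0 a aV) = t0 b bV.
  by apply: (represents_uniq d0) (t0P _ _); exact: represents_res.
exists (Limit t0C); split=> [i|t tP].
  by apply: limit_eq => a aU /=; exact: (represents_uniq d0).
apply: limit_eq => a aV /=; apply: (represents_uniq d0) => //.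
have [a0|a0] := pselect (a = 0); first exact: base_change_zero.
have [p pa] := domain_principal_open R_domain a0.
have [i [b [pb bU]]] := local p (aV p pa).
have cb : D (a * b) `<=` D b by rewrite principal_openM; exact: subIsetr.
have ca : D (a * b) `<=` D a by rewrite principal_openM; exact: subIsetl.
have c0 : a * b <> 0 by apply: principal_open0; exists p; rewrite principal_openM.
apply: (represents_res_inv (ba := ca)) => //.
rewrite (lfam_compat t aV (subset_trans ca aV)).
have := sP i _ (subset_trans cb bU); rewrite -(tP i) /=.
by rewrite (lfam_irr _ _ _ (subset_trans ca aV) (subset_trans (subset_trans cb bU) (UV i))).
Qed.

End DomainSheaf.

Theorem corollary4p5 (k : closedFieldType) (R S : comPzRingType)
    (eta : {rmorphism k -> R}) (phi : {rmorphism R -> S})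
    (hS : depiction phi eta) :
  sheaf_of_depictions eta (sheafification_unit phi).
Proof.
have [S_domain _ phi_inj _ _] := hS.
split; first exact: sheafification_sheaf.
move=> a /principal_open0 a0.
apply: (localized_depiction (global_section_localization a)
  (sheafification_section_localization phi a)) hS => // r.
exact: sheafification_unit_section.
Qed.
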